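(* Let $H=\mathbb{C}[z,z^\ast]$ be the dense $\ast$-Hopf algebra of the quantum group $\mathcal{G}$ associated with $U(1)$, let $B=\{\lambda\mathbb{1}\mid\lambda\in\mathbb{C}\}$, $P=H$ and $\Delta_P=\Delta$, so that $\zeta=(P,B,\Delta_P)$ is a quantum principal $\mathcal{G}$-bundle over $B$. Let $(\Omega^\bullet(P),d,\ast)$ be the universal differential envelope $\ast$-calculus of the classical bicovariant first order differential $\ast$-calculus of $U(1)$ (the one with associated right ideal $\mathrm{Ker}^2(\epsilon)$), so that $\Omega^\bullet(P)=P\oplus P\,\pi(z)$ with $\pi(z)=S(z)\,dz$. Let $(\Gamma,d)$ be the bicovariant first order differential $\ast$-calculus over $\mathcal{G}$ with associated right ideal $\mathcal{R}=\mathrm{Ker}(\epsilon)$, so that $\Gamma=\{0\}$ and $\Gamma^\wedge=H$. Let $\Delta_{\Omega^\bullet(P)}:\Omega^\bullet(P)\to\Omega^\bullet(P)\otimes H$ be $\Delta_P$ in degree $0$ and $\Delta_{\Omega^\bullet(P)}(g\,\pi(z))=g^{(1)}\pi(z)\otimes g^{(2)}$ for $g\in P$. Then these data form a differential calculus on $\zeta$, and its algebra of base forms is $$\Omega^\bullet(B)=B\oplus\Omega^1(B),\qquad \Omega^1(B)=\{\lambda\,\pi(z)\mid\lambda\in\mathbb{C}\}.$$ In particular, $\Omega^\bullet(B)$ is not generated by $B$ as a graded differential algebra.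
   Context: On $H=\mathbb{C}[z,z^\ast]$ (with $zz^\ast=z^\ast z=\mathbb{1}$): $\Delta(z)=z\otimes z$, $\epsilon(z)=1$, $S(z)=z^\ast$. Sweedler notation $\Delta(g)=g^{(1)}\otimes g^{(2)}$ is used. A graded differential $\ast$-algebra is an $\mathbb{N}_0$-graded unital complex algebra with a degree-one differential $d$ ($d^2=0$, graded Leibniz rule) and an antilinear involution with $(xy)^\ast=(-1)^{\partial x\,\partial y}y^\ast x^\ast$ and $d(x^\ast)=(dx)^\ast$; tensor products are graded. It is generated by a degree $0$ subalgebra $X$ if its degree $k$ part is spanned by the elements $x_0\,dx_1\cdots dx_k$ with $x_i\in X$. A first order differential $\ast$-calculus $(\Gamma,d)$ over $H$ is an $H$-bimodule $\Gamma$ with a derivation $d:H\to\Gamma$ such that $\Gamma$ is spanned by the $g\,dh$, and a compatible antilinear involution. It is bicovariant if $g\,dh\mapsto\Delta(g)(\mathrm{id}\otimes d)\Delta(h)\in H\otimes\Gamma$ and $g\,dh\mapsto\Delta(g)(d\otimes\mathrm{id})\Delta(h)\in\Gamma\otimes H$ are well defined on $\Gamma$. The associated right ideal is $\mathcal{R}=\{g\in\mathrm{Ker}(\epsilon)\mid S(g^{(1)})\,dg^{(2)}=0\}$, and it determines the calculus up to isomorphism. $\mathrm{Ker}^2(\epsilon)$ denotes the set of finite sums of products $ab$ with $a,b\in\mathrm{Ker}(\epsilon)$. The universal differential envelope is $\Gamma^\wedge=\left(\bigoplus_k\Gamma^{\otimes_H k}\right)/\mathcal{Q}$, with $\Gamma^{\otimes_H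 0}=H$, where $\mathcal{Q}$ is the two-sided ideal generated by all $\sum_i dg_i\otimes_H dh_i$ with $\sum_i g_i\,dh_i=0$. A quantum principal $\mathcal{G}$-bundle $(P,B,\Delta_P)$ consists of a unital $\ast$-algebra $P$, a unital $\ast$-subalgebra $B$, and a $\ast$-algebra morphism $\Delta_P:P\to P\otimes H$ which is a right coaction, satisfies $\Delta_P(x)=x\otimes\mathbb{1}\iff x\in B$, and for which $P\otimes P\to P\otimes H$, $x\otimes y\mapsto(x\otimes\mathbb{1})\Delta_P(y)$, is surjective. A differential calculus on it consists of (1) a graded differential $\ast$-algebra $(\Omega^\bullet(P),d,\ast)$ generated by $\Omega^0(P)=P$; (2) a bicovariant first order differential $\ast$-calculus $(\Gamma,d)$ over $\mathcal{G}$; (3) an extension of $\Delta_P$ to a graded differential $\ast$-algebra morphism $\Delta_{\Omega^\bullet(P)}:\Omega^\bullet(P)\to\Omega^\bullet(P)\otimes\Gamma^\wedge$. The base forms are $\Omega^\bullet(B)=\{\mu\in\Omega^\bullet(P)\mid\Delta_{\Omega^\bullet(P)}(\mu)=\mu\otimes\mathbb{1}\}$. *)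

(* Defs.v *)
From HB Require Import structures.
From mathcomp Require Import all_boot all_order all_algebra.
From mathcomp Require Import finmap generic_quotient.
From mathcomp Require Import monalg.
From mathcomp Require Import boolp reals complex.

Set Implicit Arguments.
Unset Strict Implicit.
Unset Printing Implicit Defensive.

Import Order.TTheory GRing.Theory Num.Theory.
Local Open Scope ring_scope.
Local Open Scope quotient_scope.

Section Quotient.
Variables (K : fieldType) (V : lmodType K) (S : V -> Prop).

Inductive span : V -> Prop :=
| span0 : span 0
| span_cons a x y : S x -> span y -> span (a *: x + y).

Lemma spanS x : S x -> span x.
Proof. by move=> Sx; rewrite -[x]scale1r -[_ *: _]addr0; do 2?constructor. Qed.

Lemma spanD x y : span x -> span y -> span (x + y).
Proof.
elim=> [|a u v Su _ IH] Sy; first by rewrite add0r.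
by rewrite -addrA; constructor=> //; exact: IH.
Qed.

Lemma spanZ a x : span x -> span (a *: x).
Proof.
elim=> [|b u v Su _ IH]; first by rewrite scaler0; constructor.
by rewrite scalerDr scalerA; constructor.
Qed.

Lemma spanN x : span x -> span (- x).
Proof. by rewrite -scaleN1r; exact: spanZ. Qed.

Definition quot_rel : rel V := fun x y => `[< span (x - y) >].

Lemma quot_rel_refl : reflexive quot_rel.
Proof. by move=> x; apply/asboolP; rewrite subrr; constructor. Qed.

Lemma quot_rel_sym : symmetric quot_rel.
Proof.
by move=> x y; apply/asboolP/asboolP=> /spanN; rewrite opprB.
Qed.

Lemma quot_rel_trans : transitive quot_rel.
Proof.
move=> y x z /asboolP xy /asboolP yz; apply/asboolP.
by have := spanD xy yz; rewrite addrA subrK.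
Qed.

Canonical quot_equiv := EquivRel quot_rel quot_rel_refl quot_rel_sym quot_rel_trans.

Definition lquot := {eq_quot quot_equiv}.
HB.instance Definition _ := Choice.on lquot.

Definition lpi (x : V) : lquot := \pi_lquot x.
Definition lrepr (q : lquot) : V := repr q.

Lemma lreprK q : lpi (lrepr q) = q.
Proof. exact: reprK. Qed.

Lemma lpiP x y : lpi x = lpi y <-> span (x - y).
Proof.
by split=> [/eqmodP /asboolP //|h]; apply/eqmodP/asboolP.
Qed.

Lemma lrepr_span x : span (lrepr (lpi x) - x).
Proof. by apply/lpiP; rewrite lreprK. Qed.

Definition lquot_add (p q : lquot) := lpi (lrepr p + lrepr q).
Definition lquot_opp (p : lquot) := lpi (- lrepr p).
Definition lquot_scale a (p : lquot) := lpi (a *: lrepr p).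

Lemma lquot_addE x y : lquot_add (lpi x) (lpi y) = lpi (x + y).
Proof.
apply/lpiP; rewrite opprD addrACA.
by apply: spanD; exact: lrepr_span.
Qed.

Lemma lquot_oppE x : lquot_opp (lpi x) = lpi (- x).
Proof. by apply/lpiP; rewrite -opprD; apply: spanN; exact: lrepr_span. Qed.

Lemma lquot_scaleE a x : lquot_scale a (lpi x) = lpi (a *: x).
Proof. by apply/lpiP; rewrite -scalerBr; apply: spanZ; exact: lrepr_span. Qed.

Lemma lquotW (P : lquot -> Prop) : (forall x, P (lpi x)) -> forall q, P q.
Proof. by move=> h q; rewrite -[q]lreprK. Qed.

Fact lquot_addA : associative lquot_add.
Proof. by do 3!elim/lquotW=> ?; rewrite !lquot_addE addrA. Qed.
Fact lquot_addC : commutative lquot_add.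
Proof. by do 2!elim/lquotW=> ?; rewrite !lquot_addE addrC. Qed.
Fact lquot_add0 : left_id (lpi 0) lquot_add.
Proof. by elim/lquotW=> ?; rewrite !lquot_addE add0r. Qed.
Fact lquot_addN : left_inverse (lpi 0) lquot_opp lquot_add.
Proof. by elim/lquotW=> ?; rewrite lquot_oppE lquot_addE addNr. Qed.

HB.instance Definition _ := GRing.isZmodule.Build lquot
  lquot_addA lquot_addC lquot_add0 lquot_addN.

Lemma lpiD x y : lpi x + lpi y = lpi (x + y).
Proof. exact: lquot_addE. Qed.

Fact lquot_scaleA a b (v : lquot) :
  lquot_scale a (lquot_scale b v) = lquot_scale (a * b) v.
Proof. by elim/lquotW: v => ?; rewrite !lquot_scaleE scalerA. Qed.
Fact lquot_scale1 : left_id 1 lquot_scale.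
Proof. by elim/lquotW=> ?; rewrite lquot_scaleE scale1r. Qed.
Fact lquot_scaleDr : right_distributive lquot_scale +%R.
Proof.
move=> a; elim/lquotW=> x; elim/lquotW=> y.
by rewrite lpiD !lquot_scaleE lpiD scalerDr.
Qed.
Fact lquot_scaleDl (v : lquot) :
  {morph lquot_scale^~ v : a b / a + b}.
Proof.
by elim/lquotW: v => x a b; rewrite !lquot_scaleE lpiD scalerDl.
Qed.

HB.instance Definition _ := GRing.Zmodule_isLmodule.Build K lquot
  lquot_scaleA lquot_scale1 lquot_scaleDr lquot_scaleDl.

Lemma lpi_is_linear : linear lpi.
Proof.
by move=> a x y; rewrite -lpiD -lquot_scaleE.
Qed.

Lemma lpi_eq0 x : lpi x = 0 <-> span x.
Proof. by rewrite -{2}[x]subr0; exact: lpiP. Qed.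

End Quotient.

Section FreeModule.
Variables (K : fieldType) (X : choiceType) (U : lmodType K).

(* The s-semilinear extension of f to the free module on X; it is locked      *)
(* because unfolding it makes failing conversions very slow.                  *)
Definition mext (s : {rmorphism K -> K}) (f : X -> U) (g : {malg K[X]}) : U :=
  locked (\sum_(k <- msupp g) s g@_k *: f k).

Lemma mextEw s f (d : {fset X}) g : (msupp g `<=` d)%fset ->
  mext s f g = \sum_(k <- d) s g@_k *: f k.
Proof.
move=> le; rewrite /mext -lock (big_fset_incl _ le) => //= x _ /mcoeff_outdom ->.
by rewrite rmorph0 scale0r.
Qed.

Lemma mextP s f a x y : mext s f (a *: x + y) = s a *: mext s f x + mext s f y.
Proof.
have lex : (msupp x `<=` msupp x `|` msupp y)%fset by exact: fsubsetUl.
have ley : (msupp y `<=` msupp x `|` msupp y)%fset by exact: fsubsetUr.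
have le : (msupp (a *: x + y) `<=` msupp x `|` msupp y)%fset.
  apply: fsubset_trans (msuppD_le _ _) _.
  by apply: fsetUSS => //; exact: msuppZ_le.
rewrite (mextEw _ _ lex) (mextEw _ _ ley) (mextEw _ _ le).
rewrite scaler_sumr -big_split /=; apply: eq_bigr => k _.
by rewrite mcoeffD mcoeffZ rmorphD rmorphM scalerDl scalerA.
Qed.

Lemma mextU s f k : mext s f << k >> = f k.
Proof.
by rewrite (mextEw _ _ msuppU_le) big_seq_fset1 mcoeffUU rmorph1 scale1r.
Qed.

Lemma mext0 s f : mext s f 0 = 0.
Proof. by rewrite /mext -lock msupp0 big_seq_fset0. Qed.

Lemma mextB s f x y : mext s f (x - y) = mext s f x - mext s f y.
Proof.
have -> : x - y = -1 *: y + x by rewrite scaleN1r addrC.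
by rewrite mextP rmorphN1 scaleN1r addrC.
Qed.

End FreeModule.

Section Tensor.
Variables (K : fieldType) (V W : lmodType K).

Inductive tens_rel : {malg K[(V * W)%type]} -> Prop :=
| tens_rel_l a u v w :
    tens_rel (<< (a *: u + v, w) >> - (a *: << (u, w) >> + << (v, w) >>))
| tens_rel_r a v u w :
    tens_rel (<< (v, a *: u + w) >> - (a *: << (v, u) >> + << (v, w) >>)).

Definition tensor := lquot tens_rel.
HB.instance Definition _ := GRing.Lmodule.on tensor.

Definition tens (v : V) (w : W) : tensor := lpi tens_rel << (v, w) >>.

(* The s-semilinear map on the tensor product sending v (x) w to f v w; this  *)
(* is meaningful when f is s-semilinear in both arguments (tliftsE below).    *)
Definition tlifts (U : lmodType K) (s : {rmorphism K -> K})
    (f : V -> W -> U) (t : tensor) : U :=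
  mext s (fun p => f p.1 p.2) (lrepr t).

Definition bisemilinear (U : lmodType K) (s : {rmorphism K -> K})
    (f : V -> W -> U) :=
  (forall w a u v, f (a *: u + v) w = s a *: f u w + f v w) /\
  (forall v a u w, f v (a *: u + w) = s a *: f v u + f v w).

Lemma tlifts_pi (U : lmodType K) s (f : V -> W -> U) x : bisemilinear s f ->
  tlifts s f (lpi tens_rel x) = mext s (fun p => f p.1 p.2) x.
Proof.
move=> [fl fr]; rewrite /tlifts.
have := lrepr_span tens_rel x; set y := lrepr _ => h.
apply/eqP; rewrite -subr_eq0 -mextB; apply/eqP.
elim: h => [|a u v Su _ IH]; first exact: mext0.
rewrite mextP IH addr0; case: Su => [b u1 v1 w1|b v1 u1 w1];
  by rewrite mextB mextP !mextU /= ?fl ?fr subrr scaler0.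
Qed.

Lemma tliftsE (U : lmodType K) s (f : V -> W -> U) v w : bisemilinear s f ->
  tlifts s f (tens v w) = f v w.
Proof. by move=> h; rewrite tlifts_pi // mextU. Qed.

Lemma tliftsP (U : lmodType K) s (f : V -> W -> U) a x y : bisemilinear s f ->
  tlifts s f (a *: x + y) = s a *: tlifts s f x + tlifts s f y.
Proof.
move=> h; elim/lquotW: x => x; elim/lquotW: y => y.
by rewrite -lpi_is_linear !tlifts_pi // mextP.
Qed.

Lemma tens_linl w a u v : tens (a *: u + v) w = a *: tens u w + tens v w.
Proof.
rewrite /tens -lpi_is_linear; apply/lpiP/spanS; exact: tens_rel_l.
Qed.

Lemma tens_linr v a u w : tens v (a *: u + w) = a *: tens v u + tens v w.
Proof.
rewrite /tens -lpi_is_linear; apply/lpiP/spanS; exact: tens_rel_r.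
Qed.

Lemma tens_ind (P : tensor -> Prop) : P 0 ->
  (forall a v w t, P t -> P (a *: tens v w + t)) -> forall t, P t.
Proof.
move=> P0 PS; elim/lquotW => x.
have -> : lpi tens_rel x =
    \sum_(k <- msupp x) x@_k *: tens k.1 k.2.
  rewrite {1}[x]monalgE; elim: (enum_fset _) => [|k s IH].
    by rewrite !big_nil.
  rewrite !big_cons -IH -lpi_is_linear; congr (lpi _ (_ + _)).
  apply/malgP => j; rewrite mcoeffZ !mcoeffU.
  by case: k {IH} => k1 k2 /=; case: eqP; rewrite ?mulr1n ?mulr0n ?mulr1 ?mulr0.
by elim: (enum_fset _) => [|k s IH]; rewrite ?big_nil ?big_cons //; exact: PS.
Qed.

End Tensor.

Notation "v ⊗ w" := (tens v w) (at level 38, left associativity) : ring_scope.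
Notation tlift f := (tlifts idfun f).

Lemma tens_bisemilinear (K : fieldType) (V W : lmodType K) :
  bisemilinear idfun (@tens K V W).
Proof. by split=> *; rewrite ?tens_linl ?tens_linr. Qed.

Definition tmap (K : fieldType) (V W V' W' : lmodType K)
    (f : V -> V') (g : W -> W') : tensor V W -> tensor V' W' :=
  tlift (fun v w => f v ⊗ g w).

Definition tassoc (K : fieldType) (U V W : lmodType K) :
    tensor U (tensor V W) -> tensor (tensor U V) W :=
  tlift (fun u t => tlift (fun v w => (u ⊗ v) ⊗ w) t).

Section TensorTheory.
Variables (K : fieldType) (V W U : lmodType K) (s : {rmorphism K -> K}).

Lemma tlifts0 (f : V -> W -> U) : bisemilinear s f -> tlifts s f 0 = 0.
Proof.
move=> h; have := tliftsP 1 0 0 h; rewrite scaler0 addr0 rmorph1 scale1r.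
by move/eqP; rewrite -subr_eq subrr eq_sym => /eqP.
Qed.

Lemma tensor_ext (f g : tensor V W -> U) :
  (forall a x y, f (a *: x + y) = s a *: f x + f y) ->
  (forall a x y, g (a *: x + y) = s a *: g x + g y) ->
  (forall v w, f (v ⊗ w) = g (v ⊗ w)) -> f =1 g.
Proof.
move=> hf hg fg; elim/tens_ind => [|a v w t IH]; last by rewrite hf hg fg IH.
have h0 (h : tensor V W -> U) :
    (forall a x y, h (a *: x + y) = s a *: h x + h y) -> h 0 = 0.
  move=> hh; have := hh 1 0 0; rewrite scaler0 addr0 rmorph1 scale1r.
  by move/eqP; rewrite -subr_eq subrr eq_sym => /eqP.
by rewrite !h0.
Qed.

End TensorTheory.

Lemma tlifts_lin (K : fieldType) (V W U : lmodType K) (a : K)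
    (f g h : V -> W -> U) t : bisemilinear idfun f ->
  bisemilinear idfun g -> bisemilinear idfun h ->
  (forall v w, f v w = a *: g v w + h v w) ->
  tlift f t = a *: tlift g t + tlift h t.
Proof.
move=> bf bg bh E; elim/tens_ind: t => [|b v w t IH].
  by rewrite (tlifts0 bf) (tlifts0 bg) (tlifts0 bh) scaler0 addr0.
rewrite (tliftsP b _ t bf) (tliftsP b _ t bg) (tliftsP b _ t bh) IH.
rewrite (tliftsE _ _ bf) (tliftsE _ _ bg) (tliftsE _ _ bh) E /=.
by rewrite !scalerDr !scalerA [a * b]mulrC addrACA.
Qed.

Lemma tmap_bi (K : fieldType) (V W V' W' : lmodType K)
    (f : V -> V') (g : W -> W') : linear f -> linear g ->
  bisemilinear idfun (fun v w => f v ⊗ g w).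
Proof. by move=> hf hg; split=> *; rewrite (hf, hg) ?tens_linl ?tens_linr. Qed.

Lemma tmapE (K : fieldType) (V W V' W' : lmodType K)
    (f : V -> V') (g : W -> W') v w : linear f -> linear g ->
  tmap f g (v ⊗ w) = f v ⊗ g w.
Proof. by move=> hf hg; apply/tliftsE/tmap_bi. Qed.

Lemma tmap_linear (K : fieldType) (V W V' W' : lmodType K)
    (f : V -> V') (g : W -> W') : linear f -> linear g -> linear (tmap f g).
Proof. by move=> hf hg a x y; apply/tliftsP/tmap_bi. Qed.

Section Associator.
Variables (K : fieldType) (U V W : lmodType K).

Lemma tassoc_bi0 (u : U) :
  bisemilinear idfun (fun (v : V) (w : W) => (u ⊗ v) ⊗ w).
Proof. by split=> *; rewrite ?tens_linr ?tens_linl. Qed.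

Lemma tassoc_bi : bisemilinear idfun
  (fun (u : U) (t : tensor V W) => tlift (fun v w => (u ⊗ v) ⊗ w) t).
Proof.
split=> [t a x y|u a x y].
  apply: tlifts_lin => [|||v w]; try exact: tassoc_bi0.
  by rewrite !tens_linl.
exact: (tliftsP a x y (tassoc_bi0 u)).
Qed.

Lemma tassocE (u : U) (v : V) (w : W) : tassoc (u ⊗ (v ⊗ w)) = (u ⊗ v) ⊗ w.
Proof.
by rewrite /tassoc (tliftsE _ _ tassoc_bi) (tliftsE _ _ (tassoc_bi0 u)).
Qed.

Lemma tassoc_linear : linear (@tassoc K U V W).
Proof. by move=> a x y; apply/tliftsP/tassoc_bi. Qed.

End Associator.

Definition antilinear (C : numClosedFieldType) (V W : lmodType C) (f : V -> W) :=
  forall a x y, f (a *: x + y) = a^* *: f x + f y.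

Record starAlg (C : numClosedFieldType) := StarAlg {
  sa_car :> algType C;
  star : sa_car -> sa_car;
  star_antilinear : antilinear star;
  starM : forall x y, star (x * y) = star y * star x;
  starK : involutive star }.

Section TensorStarAlg.
Variables (C : numClosedFieldType) (A B : starAlg C).

Definition tmul (s t : tensor A B) : tensor A B :=
  tlift (fun x a => tlift (fun y b => (x * y) ⊗ (a * b)) t) s.

Definition tstar : tensor A B -> tensor A B :=
  tlifts Num.conj (fun x a => star x ⊗ star a).

End TensorStarAlg.

Definition star_morphism_tensor (C : numClosedFieldType) (P A B : starAlg C)
    (f : P -> tensor A B) :=
  [/\ linear f, f 1 = 1 ⊗ 1, (forall x y, f (x * y) = tmul (f x) (f y))
    & forall x, f (star x) = tstar (f x)].

Record starHopf (C : numClosedFieldType) := StarHopf {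
  ha :> starAlg C;
  cop : ha -> tensor ha ha;
  eps : ha -> C;
  ant : ha -> ha;
  cop_morphism : star_morphism_tensor cop;
  copA : forall g, tmap cop id (cop g) = tassoc (tmap id cop (cop g));
  eps_linear : linear_for *%R eps;
  eps1 : eps 1 = 1;
  epsM : forall g h, eps (g * h) = eps g * eps h;
  eps_star : forall g, eps (star g) = (eps g)^*;
  eps_cop : forall g, tlift (fun a b => eps a *: b) (cop g) = g;
  cop_eps : forall g, tlift (fun a b => eps b *: a) (cop g) = g;
  ant_linear : linear ant;
  ant_cop : forall g, tlift (fun a b => ant a * b) (cop g) = (eps g)%:A;
  cop_ant : forall g, tlift (fun a b => a * ant b) (cop g) = (eps g)%:A;
  ant_star : forall g, ant (star (ant (star g))) = g }.

Definition star_subalgebra (C : numClosedFieldType) (P : starAlg C)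
    (B : P -> Prop) :=
  [/\ B 1, forall a x y, B x -> B y -> B (a *: x + y),
      forall x y, B x -> B y -> B (x * y) & forall x, B x -> B (star x)].

Record is_qpb (C : numClosedFieldType) (H : starHopf C) (P : starAlg C)
    (B : P -> Prop) (coactP : P -> tensor P H) : Prop := IsQpb {
  qpb_base : star_subalgebra B;
  qpb_morphism : star_morphism_tensor coactP;
  qpb_coassoc : forall x,
    tmap coactP id (coactP x) = tassoc (tmap id (@cop C H) (coactP x));
  qpb_counit : forall x, tlift (fun y h => eps h *: y) (coactP x) = x;
  qpb_inv : forall x, coactP x = x ⊗ 1 <-> B x;
  qpb_free : forall t : tensor P H, exists s : tensor P P,
    tlift (fun x y => tmul (x ⊗ 1) (coactP y)) s = t }.

Record fodc (C : numClosedFieldType) (A : starAlg C) := Fodc {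
  form1 :> lmodType C;
  lact : A -> form1 -> form1;
  ract : form1 -> A -> form1;
  dif1 : A -> form1;
  star1 : form1 -> form1;
  lact_linl : forall w, linear (lact^~ w);
  lact_linr : forall g, linear (lact g);
  ract_linl : forall g, linear (ract^~ g);
  ract_linr : forall w, linear (ract w);
  lact1 : forall w, lact 1 w = w;
  lactM : forall g h w, lact (g * h) w = lact g (lact h w);
  ract1 : forall w, ract w 1 = w;
  ractM : forall g h w, ract w (g * h) = ract (ract w g) h;
  lract : forall g w h, ract (lact g w) h = lact g (ract w h);
  dif1_linear : linear dif1;
  dif1M : forall g h, dif1 (g * h) = ract (dif1 g) h + lact g (dif1 h);
  form1_span : forall w, span (fun v => exists g h, v = lact g (dif1 h)) w;
  star1_antilinear : antilinear star1;
  star1K : involutive star1;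
  star1_lact : forall g w, star1 (lact g w) = ract (star1 w) (star g);
  star1_dif : forall g, star1 (dif1 g) = dif1 (star g) }.

Section HopfCalculus.
Variables (C : numClosedFieldType) (H : starHopf C) (G : fodc H).

(* Delta(g) (id (x) d) Delta(h) and Delta(g) (d (x) id) Delta(h). *)
Definition lcoact (g h : H) : tensor H G :=
  tlift (fun a b => tlift (fun c e => (a * c) ⊗ lact b (dif1 G e)) (cop h))
    (cop g).
Definition rcoact (g h : H) : tensor G H :=
  tlift (fun a b => tlift (fun c e => lact a (dif1 G c) ⊗ (b * e)) (cop h))
    (cop g).

Definition bicovariant := forall s : seq (H * H),
  \sum_(p <- s) lact p.1 (dif1 G p.2) = 0 ->
  \sum_(p <- s) lcoact p.1 p.2 = 0 /\ \sum_(p <- s) rcoact p.1 p.2 = 0.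

Definition right_ideal (g : H) :=
  eps g = 0 /\ tlift (fun a b => lact (ant a) (dif1 G b)) (cop g) = 0.

End HopfCalculus.

Definition ker_eps2 (C : numClosedFieldType) (H : starHopf C) : H -> Prop :=
  span (fun g => exists a b : H, [/\ eps a = 0, eps b = 0 & g = a * b]).

(* The grading is given by the projections hcomp k onto the homogeneous       *)
(* components.                                                                *)
Record gdsa (C : numClosedFieldType) := Gdsa {
  g_alg :> algType C;
  hcomp : nat -> g_alg -> g_alg;
  dif : g_alg -> g_alg;
  gstar : g_alg -> g_alg;
  homog := fun k x => hcomp k x = x;
  hcomp_linear : forall k, linear (hcomp k);
  hcomp_proj : forall i j x, hcomp i (hcomp j x) = if i == j then hcomp j x else 0;
  hcomp_fin : forall x, exists n, (forall k, (n <= k)%N -> hcomp k x = 0) /\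
    x = \sum_(k < n) hcomp k x;
  hom1 : homog 0 1;
  homM : forall i j x y, homog i x -> homog j y -> homog (i + j) (x * y);
  dif_linear : linear dif;
  dif_hom : forall k x, homog k x -> homog k.+1 (dif x);
  difK : forall x, dif (dif x) = 0;
  difM : forall k x y, homog k x ->
    dif (x * y) = dif x * y + (-1) ^+ k *: (x * dif y);
  gstar_antilinear : antilinear gstar;
  gstar_hom : forall k x, homog k x -> homog k (gstar x);
  gstarK : involutive gstar;
  gstarM : forall i j x y, homog i x -> homog j y ->
    gstar (x * y) = (-1) ^+ (i * j) *: (gstar y * gstar x);
  gstar_dif : forall x, gstar (dif x) = dif (gstar x) }.

Section GdsaTheory.
Variables (C : numClosedFieldType) (W : gdsa C).

Definition hbound (x : W) : nat := projT1 (cid (hcomp_fin x)).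

(* Spanned by the x_0 dx_1 ... dx_k with all x_i in X. *)
Definition gen_deg (X : W -> Prop) (k : nat) : W -> Prop :=
  span (fun w => exists x0 (s : seq W), [/\ X x0, {in s, forall x, X x},
    size s = k & w = x0 * \prod_(x <- s) dif x]).

(* The graded subalgebra S is generated by its degree 0 elements X. *)
Definition generated_by (S X : W -> Prop) :=
  forall k w, (S w /\ homog k w) <-> gen_deg X k w.

End GdsaTheory.

Section GradedTensor.
Variables (C : numClosedFieldType) (A B : gdsa C).

(* (x (x) a)(y (x) b) = (-1)^(deg a deg y) xy (x) ab *)
Definition gtmul (s t : tensor A B) : tensor A B :=
  tlift (fun x a => tlift (fun y b =>
    \sum_(i < hbound a) \sum_(j < hbound y)
      (-1) ^+ (i * j) *: ((x * hcomp j y) ⊗ (hcomp i a * b))) t) s.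

(* d(x (x) a) = dx (x) a + (-1)^(deg x) x (x) da *)
Definition gtdif : tensor A B -> tensor A B :=
  tlift (fun x a =>
    dif x ⊗ a + \sum_(i < hbound x) (-1) ^+ i *: (hcomp i x ⊗ dif a)).

Definition gtstar : tensor A B -> tensor A B :=
  tlifts Num.conj (fun x a => gstar x ⊗ gstar a).

Definition gthom (k : nat) : tensor A B -> Prop :=
  span (fun t => exists i j x a,
    [/\ (i + j = k)%N, homog i x, homog j a & t = x ⊗ a]).

Record gdsa_morphism_tensor (Omega : gdsa C) (f : Omega -> tensor A B) : Prop :=
  GdsaMorphismTensor {
    gmt_linear : linear f;
    gmt_hom : forall k x, homog k x -> gthom k (f x);
    gmt1 : f 1 = 1 ⊗ 1;
    gmtM : forall x y, f (x * y) = gtmul (f x) (f y);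
    gmt_dif : forall x, f (dif x) = gtdif (f x);
    gmt_star : forall x, f (gstar x) = gtstar (f x) }.

End GradedTensor.

(* Only the action of a left module is recorded, not its laws; the type is    *)
(* used for the tensor powers below.                                          *)
Record lmodule (C : numClosedFieldType) (A : algType C) := LModule {
  lm_car :> lmodType C;
  lm_act : A -> lm_car -> lm_car }.

Section Envelope.
Variables (C : numClosedFieldType) (A : starAlg C) (G : fodc A).

Inductive bal_rel (T : lmodule A) : tensor G T -> Prop :=
| BalRel w h t : bal_rel (ract w h ⊗ t - w ⊗ lm_act h t).

(* The balanced tensor product of the bimodule G with the left module T. *)
Definition btensor (T : lmodule A) := lquot (@bal_rel T).
HB.instance Definition _ (T : lmodule A) := GRing.Lmodule.on (btensor T).

Definition bt (T : lmodule A) (w : G) (t : T) : btensor T := lpi _ (w ⊗ t).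

Definition blift (T : lmodule A) (U : lmodType C) (f : G -> T -> U)
  (q : btensor T) : U := tlift f (lrepr q).

(* Tensor powers over A of G, as left A-modules: the 0th one is A and the     *)
(* (k+1)st one is the product of G with the kth one; so the first one is the  *)
(* product of G and A, in which w : G is identified with bt w 1.              *)
Fixpoint tpow (k : nat) : lmodule A :=
  if k isn't k'.+1 then @LModule C A A *%R
  else @LModule C A (btensor (tpow k'))
         (fun h => blift (fun w t => bt (lact h w) t)).

Definition tpow1 (w : G) : tpow 1 := @bt (tpow 0) w 1.
Definition tpow2 (v w : G) : tpow 2 := @bt (tpow 1) v (tpow1 w).

(* The product of the tensor algebra, (w (x) s) t = w (x) (s t). *)
Fixpoint tpow_mul (i j : nat) : tpow i -> tpow j -> tpow (i + j)%coq_nat :=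
  if i isn't i'.+1 then fun h t => lm_act h t
  else fun s t => blift (fun w s' => @bt (tpow _) w (tpow_mul s' t)) s.

(* The homogeneous components of the two-sided ideal Q of the tensor algebra; *)
(* Q is graded, since it is generated by homogeneous elements of degree 2.    *)
Inductive env_ideal : forall k, tpow k -> Prop :=
| env_gen (s : seq (A * A)) :
    \sum_(p <- s) lact p.1 (dif1 G p.2) = 0 ->
    env_ideal (\sum_(p <- s) tpow2 (dif1 G p.1) (dif1 G p.2))
| env_0 k : @env_ideal k 0
| env_lin k a (s t : tpow k) :
    env_ideal s -> env_ideal t -> env_ideal (a *: s + t)
| env_mull i j (s : tpow i) (t : tpow j) :
    env_ideal t -> env_ideal (tpow_mul s t)
| env_mulr i j (s : tpow i) (t : tpow j) :
    env_ideal s -> env_ideal (tpow_mul s t).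

(* The quotient of the tensor algebra by Q, up to isomorphism: a graded       *)
(* algebra with a surjective graded morphism from the tensor algebra of kernel *)
(* Q, together with the differential and the involution extending those of G. *)
Record envelope := Envelope {
  env_alg :> gdsa C;
  env_pi : forall k, tpow k -> env_alg;
  env_pi_linear : forall k, linear (@env_pi k);
  env_pi_hom : forall k w, homog k w <-> exists t : tpow k, w = env_pi t;
  env_pi_ker : forall k (t : tpow k), env_pi t = 0 <-> env_ideal t;
  env_pi1 : @env_pi 0 1 = 1;
  env_piM : forall i j (s : tpow i) (t : tpow j),
    env_pi (tpow_mul s t) = env_pi s * env_pi t;
  env_dif : forall g : A, dif (@env_pi 0 g) = env_pi (tpow1 (dif1 G g));
  env_star0 : forall g : A, gstar (@env_pi 0 g) = @env_pi 0 (star g);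
  env_star1 : forall w : G, gstar (env_pi (tpow1 w)) = env_pi (tpow1 (star1 w)) }.

Definition env_in (W : envelope) (g : A) : W := @env_pi W 0 g.

End Envelope.

Section Calculus.
Variables (C : numClosedFieldType) (H : starHopf C) (P : starAlg C).
Variables (Omega : gdsa C) (inP : P -> Omega) (G : fodc H) (W : envelope G).

(* inP identifies P with the degree 0 part of Omega. *)
Definition degree0 : Prop :=
  [/\ linear inP /\ injective inP, inP 1 = 1,
      forall x y, inP (x * y) = inP x * inP y,
      forall x, inP (star x) = gstar (inP x)
    & forall w, homog 0 w <-> exists x, w = inP x].

Record is_calculus (coactP : P -> tensor P H)
    (coact : Omega -> tensor Omega W) : Prop := IsCalculus {
  calc_degree0 : degree0;
  calc_generated : generated_by (fun=> True) (fun w => exists x, w = inP x);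
  calc_bicovariant : bicovariant G;
  calc_morphism : gdsa_morphism_tensor coact;
  calc_extends : forall x, coact (inP x) = tmap inP (env_in W) (coactP x) }.

Definition base_form (coact : Omega -> tensor Omega W) (w : Omega) :=
  coact w = w ⊗ 1.

End Calculus.

Section TensorStarAlgTheory.
Variables (C : numClosedFieldType) (A B : starAlg C).

Lemma tmul_bi0 (x : A) (a : B) :
  bisemilinear idfun (fun (y : A) (b : B) => (x * y) ⊗ (a * b)).
Proof.
by split=> *; rewrite mulrDr -scalerAr ?tens_linl ?tens_linr.
Qed.

Lemma tmul_bi (t : tensor A B) : bisemilinear idfun
  (fun (x : A) (a : B) => tlift (fun y b => (x * y) ⊗ (a * b)) t).
Proof.
split=> u c v w; (apply: tlifts_lin => [|||y z]; try exact: tmul_bi0);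
  by rewrite mulrDl -scalerAl ?tens_linl ?tens_linr.
Qed.

Lemma tmulE (x y : A) (a b : B) :
  tmul (x ⊗ a) (y ⊗ b) = (x * y) ⊗ (a * b).
Proof.
by rewrite /tmul (tliftsE _ _ (tmul_bi _)) (tliftsE _ _ (tmul_bi0 _ _)).
Qed.

Lemma tmul_linl (t : tensor A B) a x y :
  tmul (a *: x + y) t = a *: tmul x t + tmul y t.
Proof. exact/tliftsP/tmul_bi. Qed.

Lemma tmul_linr (s : tensor A B) : linear (tmul s).
Proof.
move=> c x y; apply: tlifts_lin => [|||u v]; try exact: tmul_bi.
exact/tliftsP/tmul_bi0.
Qed.

Lemma tstar_bi :
  bisemilinear Num.conj (fun (x : A) (a : B) => star x ⊗ star a).
Proof. by split=> *; rewrite star_antilinear ?tens_linl ?tens_linr. Qed.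

Lemma tstarE (x : A) (a : B) : tstar (x ⊗ a) = star x ⊗ star a.
Proof. exact/tliftsE/tstar_bi. Qed.

Lemma tstar_antilinear : antilinear (@tstar C A B).
Proof. by move=> a x y; apply/tliftsP/tstar_bi. Qed.

End TensorStarAlgTheory.

Section GradedTensorTheory.
Variables (C : numClosedFieldType) (A B : gdsa C).

Lemma hcomp_hom (W : gdsa C) i j (x : W) : homog j x -> hcomp i x = if i == j then x else 0.
Proof. by move=> hx; rewrite -{1}hx hcomp_proj hx. Qed.

Lemma hboundP (W : gdsa C) (x : W) k : (hbound x <= k)%N -> hcomp k x = 0.
Proof. by move=> le; rewrite /hbound in le; case: cid le => n [] /= h _ /h. Qed.

Lemma hcomp0 (W : gdsa C) k : @hcomp C W k 0 = 0.
Proof.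
have := hcomp_linear k (-1) (0 : W) 0.
by rewrite scaler0 addr0 scaleN1r addNr.
Qed.

Lemma hbound_sum (W : gdsa C) (U : lmodType C) (f : nat -> W -> U) (x : W) n :
  (forall k, f k 0 = 0) -> (hbound x <= n)%N ->
  \sum_(i < hbound x) f i (hcomp i x) = \sum_(i < n) f i (hcomp i x).
Proof.
move=> f0 le; rewrite (big_ord_widen n (fun i => f i (hcomp i x)) le).
rewrite big_mkcond /=; apply: eq_bigr => i _.
by case: ltnP => // /hboundP ->.
Qed.

Lemma hbound_linear (W : gdsa C) (U : lmodType C) (f : nat -> W -> U) :
  (forall k, linear (f k)) ->
  linear (fun x : W => \sum_(i < hbound x) f i (hcomp i x)).
Proof.
move=> fl a x y.
have f0 k : f k 0 = 0.
  by have := fl k (-1) 0 0; rewrite scaler0 addr0 scaleN1r addNr.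
pose n := maxn (hbound (a *: x + y)) (maxn (hbound x) (hbound y)).
rewrite !(hbound_sum (n := n)) ?leq_max ?leqnn ?orbT //.
by rewrite scaler_sumr -big_split; apply: eq_bigr => i _; rewrite hcomp_linear fl.
Qed.

Lemma hbound_hom (W : gdsa C) (U : lmodType C) (f : nat -> W -> U) k (x : W) :
  (forall k, f k 0 = 0) -> homog k x -> \sum_(i < hbound x) f i (hcomp i x) = f k x.
Proof.
move=> f0 hx; rewrite (hbound_sum (n := maxn (hbound x) k.+1)) ?leq_maxl //.
have lk : (k < maxn (hbound x) k.+1)%N by rewrite leq_max ltnSn orbT.
rewrite (bigD1 (Ordinal lk)) //= hx big1 ?addr0 // => i ne.
by rewrite (hcomp_hom i hx); case: eqP => // e; rewrite -(inj_eq val_inj) /= e eqxx in ne.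
Qed.

Lemma gtmul_bi0 (x : A) (a : B) : bisemilinear idfun (fun (y : A) (b : B) =>
    \sum_(i < hbound a) \sum_(j < hbound y)
      (-1) ^+ (i * j) *: ((x * hcomp j y) ⊗ (hcomp i a * b))).
Proof.
split=> [b c y y'|y c b b'].
  rewrite scaler_sumr -big_split; apply: eq_bigr => i _ /=.
  apply: (@hbound_linear A _
    (fun j y => (-1) ^+ (i * j) *: ((x * y) ⊗ (hcomp i a * b)))) => j d u v.
  by rewrite mulrDr -scalerAr tens_linl scalerDr !scalerA [d * _]mulrC.
rewrite scaler_sumr -big_split; apply: eq_bigr => i _ /=.
rewrite scaler_sumr -big_split; apply: eq_bigr => j _ /=.
by rewrite mulrDr -scalerAr tens_linr scalerDr !scalerA [c * _]mulrC.
Qed.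

Lemma gtmul_bi (t : tensor A B) : bisemilinear idfun (fun (x : A) (a : B) =>
  tlift (fun y b => \sum_(i < hbound a) \sum_(j < hbound y)
      (-1) ^+ (i * j) *: ((x * hcomp j y) ⊗ (hcomp i a * b))) t).
Proof.
split=> u c v w; apply: tlifts_lin => [|||y z]; try exact: gtmul_bi0.
  rewrite scaler_sumr -big_split; apply: eq_bigr => i _ /=.
  rewrite scaler_sumr -big_split; apply: eq_bigr => j _ /=.
  by rewrite mulrDl -scalerAl tens_linl scalerDr !scalerA [c * _]mulrC.
apply: (@hbound_linear B _ (fun i a => \sum_(j < hbound y)
   (-1) ^+ (i * j) *: ((u * hcomp j y) ⊗ (a * z)))) => i d a a'.
rewrite scaler_sumr -big_split; apply: eq_bigr => j _ /=.
by rewrite mulrDl -scalerAl tens_linr scalerDr !scalerA [d * _]mulrC.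
Qed.

Lemma gtmulE i j (x y : A) (a b : B) : homog i a -> homog j y ->
  gtmul (x ⊗ a) (y ⊗ b) = (-1) ^+ (i * j) *: ((x * y) ⊗ (a * b)).
Proof.
move=> ha hy; rewrite /gtmul (tliftsE _ _ (gtmul_bi _)) (tliftsE _ _ (gtmul_bi0 _ _)).
have t0 (p : tensor A B) : 0 *: p = 0 by rewrite scale0r.
have tl0 (q : B) : (0 : A) ⊗ q = 0.
  by have := tens_linl q (-1) (0 : A) 0; rewrite scaler0 addr0 scaleN1r addNr.
have tr0 (q : A) : q ⊗ (0 : B) = 0.
  by have := tens_linr q (-1) (0 : B) 0; rewrite scaler0 addr0 scaleN1r addNr.
rewrite (@hbound_hom B _ (fun i a => \sum_(j < hbound y)
   (-1) ^+ (i * j) *: ((x * hcomp j y) ⊗ (a * b))) _ _ _ ha).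
  rewrite (@hbound_hom A _ (fun j y => (-1) ^+ (i * j) *: ((x * y) ⊗ (a * b))) _ _ _ hy) //.
  by move=> k; rewrite mulr0 tl0 scaler0.
by move=> k; rewrite big1 // => l _; rewrite mul0r tr0 scaler0.
Qed.

Lemma gtdif_bi : bisemilinear idfun (fun (x : A) (a : B) =>
    dif x ⊗ a + \sum_(i < hbound x) (-1) ^+ i *: (hcomp i x ⊗ dif a)).
Proof.
split=> [a c x x'|x c a a'].
  rewrite dif_linear tens_linl.
  rewrite (@hbound_linear A _ (fun i x => (-1) ^+ i *: (x ⊗ dif a))) => [|i d u v].
    by rewrite scalerDr addrACA.
  by rewrite tens_linl scalerDr !scalerA [d * _]mulrC.
rewrite dif_linear tens_linr scalerDr addrACA scaler_sumr -big_split; congr (_ + _).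
apply: eq_bigr => i _ /=.
by rewrite tens_linr scalerDr !scalerA [c * _]mulrC.
Qed.

Lemma gtdifE i (x : A) (a : B) : homog i x ->
  gtdif (x ⊗ a) = dif x ⊗ a + (-1) ^+ i *: (x ⊗ dif a).
Proof.
move=> hx; rewrite /gtdif (tliftsE _ _ gtdif_bi); congr (_ + _).
apply: (@hbound_hom A _ (fun i x => (-1) ^+ i *: (x ⊗ dif a))) => // k.
by have := tens_linl (dif a) (-1) (0 : A) 0;
  rewrite scaler0 addr0 scaleN1r addNr => ->; rewrite scaler0.
Qed.

Lemma gtstarE (x : A) (a : B) : gtstar (x ⊗ a) = gstar x ⊗ gstar a.
Proof.
by apply: tliftsE; split=> *; rewrite gstar_antilinear ?tens_linl ?tens_linr.
Qed.

End GradedTensorTheory.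

(* C[z, z^*] with z z^* = z^* z = 1: the Laurent polynomials, with basis the  *)
(* powers z^n, n : int, where z^* = z^(-1).                                   *)
Definition laurent (C : numClosedFieldType) := {malg C[int]}.
HB.instance Definition _ (C : numClosedFieldType) :=
  GRing.Lmodule.on (laurent C).

Lemma lincombC (K : comRingType) (V : lmodType K) (a b : K) (p q r s : V) :
  b *: (a *: p + q) + (a *: r + s) = a *: (b *: p + r) + (b *: q + s).
Proof. by rewrite !scalerDr !scalerA [b * a]mulrC addrACA. Qed.

Section Laurent.
Variable C : numClosedFieldType.
Local Notation L := (laurent C).

Definition zpow (n : int) : L := << n >>.

(* The s-semilinear map sending z^n to f n. *)
Definition lext (U : lmodType C) (s : {rmorphism C -> C}) (f : int -> U)
  (g : L) : U := mext s f g.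

Lemma lextP (U : lmodType C) s (f : int -> U) a x y :
  lext s f (a *: x + y) = s a *: lext s f x + lext s f y.
Proof. exact: mextP. Qed.

Lemma lextU (U : lmodType C) s (f : int -> U) n : lext s f (zpow n) = f n.
Proof. exact: mextU. Qed.

Lemma laurent_ind (P : L -> Prop) : P 0 ->
  (forall a n x, P x -> P (a *: zpow n + x)) -> forall x, P x.
Proof.
move=> P0 PS x; rewrite [x]monalgE.
elim: (enum_fset _) => [|k s IH]; rewrite ?big_nil ?big_cons //.
suff -> : << x@_k *g k >> = x@_k *: zpow k by exact: PS.
by apply/malgP => j; rewrite mcoeffZ !mcoeffU; case: eqP;
   rewrite ?mulr1n ?mulr0n ?mulr1 ?mulr0.
Qed.

Lemma laurent_ext (U : lmodType C) (s : {rmorphism C -> C}) (f g : L -> U) :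
  (forall a x y, f (a *: x + y) = s a *: f x + f y) ->
  (forall a x y, g (a *: x + y) = s a *: g x + g y) ->
  (forall n, f (zpow n) = g (zpow n)) -> f =1 g.
Proof.
move=> hf hg fg; elim/laurent_ind => [|a n x IH]; last by rewrite hf hg fg IH.
have h0 (h : L -> U) : (forall a x y, h (a *: x + y) = s a *: h x + h y) ->
    h 0 = 0.
  move=> hh; have := hh 1 0 0; rewrite scaler0 addr0 rmorph1 scale1r.
  by move/eqP; rewrite -subr_eq subrr eq_sym => /eqP.
by rewrite !h0.
Qed.

Definition laurent_mul (x y : L) : L :=
  lext idfun (fun m => lext idfun (fun n => zpow (m + n)) y) x.

Lemma laurent_mulPl y a u v :
  laurent_mul (a *: u + v) y = a *: laurent_mul u y + laurent_mul v y.
Proof. exact: lextP. Qed.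

Lemma laurent_mulUP n a u v : laurent_mul (zpow n) (a *: u + v) =
  a *: laurent_mul (zpow n) u + laurent_mul (zpow n) v.
Proof. by rewrite /laurent_mul !lextU lextP. Qed.

Lemma laurent_mul0 y : laurent_mul 0 y = 0.
Proof. exact: mext0. Qed.

Lemma laurent_mulPr x a u v :
  laurent_mul x (a *: u + v) = a *: laurent_mul x u + laurent_mul x v.
Proof.
elim/laurent_ind: x => [|b n x IH]; first by rewrite !laurent_mul0 scaler0 addr0.
rewrite (laurent_mulPl _ b) IH laurent_mulUP (laurent_mulPl u b).
by rewrite (laurent_mulPl v b); exact: lincombC.
Qed.

Lemma laurent_mulU m n : laurent_mul (zpow m) (zpow n) = zpow (m + n).
Proof. by rewrite /laurent_mul !lextU. Qed.

Lemma laurent_mulA : associative laurent_mul.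
Proof.
move=> x y z; move: x; apply: (@laurent_ext _ idfun) => [a u v|a u v|m].
- by rewrite laurent_mulPl.
- by rewrite !laurent_mulPl.
move: y; apply: (@laurent_ext _ idfun) => [a u v|a u v|n].
- by rewrite laurent_mulPl laurent_mulPr.
- by rewrite laurent_mulPr laurent_mulPl.
move: z; apply: (@laurent_ext _ idfun) => [a u v|a u v|p].
- by rewrite !laurent_mulPr.
- by rewrite laurent_mulPr.
by rewrite !laurent_mulU addrA.
Qed.

Lemma laurent_mulC : commutative laurent_mul.
Proof.
move=> x y; move: x; apply: (@laurent_ext _ idfun) => [a u v|a u v|m].
- by rewrite laurent_mulPl.
- by rewrite laurent_mulPr.
move: y; apply: (@laurent_ext _ idfun) => [a u v|a u v|n].
- by rewrite laurent_mulPr.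
- by rewrite laurent_mulPl.
by rewrite !laurent_mulU addrC.
Qed.

Lemma laurent_mul1 : left_id (zpow 0) laurent_mul.
Proof.
apply: (@laurent_ext _ idfun) => [a u v|//|n]; first by rewrite laurent_mulPr.
by rewrite laurent_mulU add0r.
Qed.

Lemma laurent_mulDl : left_distributive laurent_mul +%R.
Proof.
by move=> x y z; rewrite -[x in LHS]scale1r laurent_mulPl scale1r.
Qed.

Lemma laurent_1_neq0 : zpow 0 != 0.
Proof. by apply/eqP/malgP => /(_ 0); rewrite mcoeffU mcoeff0 => /eqP; rewrite oner_eq0. Qed.

HB.instance Definition _ := GRing.Zmodule_isComNzRing.Build L
  laurent_mulA laurent_mulC laurent_mul1 laurent_mulDl laurent_1_neq0.

Lemma laurent_scaleAl (a : C) (u v : L) : a *: (u * v) = (a *: u) * v.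
Proof.
rewrite -[a *: u]addr0 [RHS]laurent_mulPl -[RHS]/(a *: (u * v) + 0 * v).
by rewrite mul0r addr0.
Qed.

HB.instance Definition _ := GRing.Lmodule_isLalgebra.Build C L laurent_scaleAl.
HB.instance Definition _ := GRing.Lalgebra_isComAlgebra.Build C L.

Lemma zpowM m n : zpow m * zpow n = zpow (m + n).
Proof. exact: laurent_mulU. Qed.

Definition laurent_star : L -> L := lext Num.conj (fun n => zpow (- n)).

Lemma laurent_star_antilinear : antilinear laurent_star.
Proof. exact: lextP. Qed.

Lemma laurent_starU n : laurent_star (zpow n) = zpow (- n).
Proof. exact: lextU. Qed.

Lemma laurent_starM x y :
  laurent_star (x * y) = laurent_star y * laurent_star x.
Proof.
move: x; apply: (@laurent_ext _ Num.conj) => [a u v|a u v|m].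
- by rewrite mulrDl -scalerAl laurent_star_antilinear.
- by rewrite laurent_star_antilinear mulrDr -scalerAr.
move: y; apply: (@laurent_ext _ Num.conj) => [a u v|a u v|n].
- by rewrite mulrDr -scalerAr laurent_star_antilinear.
- by rewrite laurent_star_antilinear mulrDl -scalerAl.
by rewrite zpowM !laurent_starU zpowM opprD addrC.
Qed.

Lemma laurent_starK : involutive laurent_star.
Proof.
apply: (@laurent_ext _ idfun) => [a u v|//|n].
  by rewrite !laurent_star_antilinear conjCK.
by rewrite !laurent_starU opprK.
Qed.

Definition U1_alg : starAlg C :=
  StarAlg laurent_star_antilinear laurent_starM laurent_starK.

Definition laurent_cop : L -> tensor U1_alg U1_alg :=
  lext idfun (fun n => (zpow n : U1_alg) ⊗ (zpow n : U1_alg)).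
Definition laurent_eps : L -> C^o := lext idfun (fun=> 1).
Definition laurent_ant : L -> L := lext idfun (fun n => zpow (- n)).

Lemma laurent_copP : linear laurent_cop. Proof. exact: lextP. Qed.
Lemma laurent_epsP : linear laurent_eps. Proof. exact: lextP. Qed.
Lemma laurent_antP : linear laurent_ant. Proof. exact: lextP. Qed.
Lemma laurent_copU n :
  laurent_cop (zpow n) = (zpow n : U1_alg) ⊗ (zpow n : U1_alg).
Proof. exact: lextU. Qed.
Lemma laurent_epsU n : laurent_eps (zpow n) = 1. Proof. exact: lextU. Qed.
Lemma laurent_antU n : laurent_ant (zpow n) = zpow (- n).
Proof. exact: lextU. Qed.

End Laurent.

Section U1.
Variable C : numClosedFieldType.
Local Notation L := (laurent C).
Local Notation A := (U1_alg C).

Lemma laurent_cop_morphism : star_morphism_tensor (@laurent_cop C : A -> _).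
Proof.
split; [exact: laurent_copP|exact: laurent_copU| |].
  move=> x y; move: x; apply: (@laurent_ext _ _ idfun) => [a u v|a u v|m].
  - by rewrite mulrDl -scalerAl laurent_copP.
  - by rewrite laurent_copP tmul_linl.
  move: y; apply: (@laurent_ext _ _ idfun) => [a u v|a u v|n].
  - by rewrite mulrDr -scalerAr laurent_copP.
  - by rewrite laurent_copP tmul_linr.
  by rewrite zpowM !laurent_copU tmulE -zpowM.
apply: (@laurent_ext _ _ Num.conj) => [a u v|a u v|n].
- by rewrite (@star_antilinear _ A) laurent_copP.
- by rewrite laurent_copP tstar_antilinear.
by rewrite /= laurent_starU !laurent_copU tstarE /= laurent_starU.
Qed.

Lemma laurent_copA (g : A) :
  tmap (@laurent_cop C : A -> _) id (laurent_cop g) =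
  tassoc (tmap id (@laurent_cop C : A -> _) (laurent_cop g)).
Proof.
have lid : linear (id : A -> A) by [].
have lc : linear (@laurent_cop C : A -> _) := @laurent_copP C.
move: g; apply: (@laurent_ext _ _ idfun) => [a u v|a u v|n].
- by rewrite laurent_copP (tmap_linear lc lid).
- rewrite laurent_copP (tmap_linear lid lc a (laurent_cop u)).
  exact: tassoc_linear.
by rewrite laurent_copU (tmapE _ _ lc lid) (tmapE _ _ lid lc) laurent_copU tassocE.
Qed.

Lemma laurent_epsM (g h : L) :
  laurent_eps (g * h) = laurent_eps g * laurent_eps h :> C.
Proof.
move: g; apply: (@laurent_ext _ C^o idfun) => [a u v|a u v|m].
- by rewrite mulrDl -scalerAl laurent_epsP.
- by rewrite laurent_epsP mulrDl -scalerAl.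
move: h; apply: (@laurent_ext _ C^o idfun) => [a u v|a u v|n].
- by rewrite mulrDr -scalerAr laurent_epsP.
- by rewrite laurent_epsP mulrDr -scalerAr.
by rewrite zpowM !laurent_epsU mulr1.
Qed.

Lemma laurent_eps_star (g : L) :
  laurent_eps (laurent_star g) = (laurent_eps g)^* :> C.
Proof.
move: g; apply: (@laurent_ext _ C^o Num.conj) => [a u v|a u v|n].
- by rewrite laurent_star_antilinear laurent_epsP.
- by rewrite laurent_epsP rmorphD rmorphM.
by rewrite laurent_starU !laurent_epsU rmorph1.
Qed.

Lemma laurent_sweedler (f : A -> A -> A) (k : L -> L) :
  bisemilinear idfun f -> linear k ->
  (forall n, f (zpow C n) (zpow C n) = k (zpow C n)) ->
  forall g, tlift f (laurent_cop g) = k g.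
Proof.
move=> hf hk fk; apply: (@laurent_ext _ _ idfun) => [a u v|//|n].
  by rewrite laurent_copP (tliftsP _ _ _ hf).
by rewrite laurent_copU (tliftsE _ _ hf).
Qed.

Lemma laurent_eps_alg_linear :
  linear (fun g : L => (laurent_eps g)%:A : L).
Proof. by move=> a x y; rewrite laurent_epsP scalerDl scalerA. Qed.

Lemma laurent_eps_cop (g : A) :
  tlift (fun a b : A => laurent_eps a *: b) (laurent_cop g) = g.
Proof.
apply: (@laurent_sweedler _ id) => // [|n]; last by rewrite laurent_epsU scale1r.
split=> [w a u v|v a u w]; first by rewrite laurent_epsP scalerDl scalerA.
by rewrite scalerDr !scalerA [a * _]mulrC.
Qed.

Lemma laurent_cop_eps (g : A) :
  tlift (fun a b : A => laurent_eps b *: a) (laurent_cop g) = g.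
Proof.
apply: (@laurent_sweedler _ id) => // [|n]; last by rewrite laurent_epsU scale1r.
split=> [w a u v|v a u w]; last by rewrite laurent_epsP scalerDl scalerA.
by rewrite scalerDr !scalerA [a * _]mulrC.
Qed.

Lemma laurent_ant_cop (g : A) :
  tlift (fun a b : A => laurent_ant a * b) (laurent_cop g) = (laurent_eps g)%:A.
Proof.
apply: (@laurent_sweedler _ (fun g => (laurent_eps g)%:A)) => [||n].
- split=> [w a u v|v a u w]; first by rewrite laurent_antP mulrDl -scalerAl.
  by rewrite mulrDr -scalerAr.
- exact: laurent_eps_alg_linear.
by rewrite laurent_antU zpowM addNr laurent_epsU scale1r.
Qed.

Lemma laurent_cop_ant (g : A) :
  tlift (fun a b : A => a * laurent_ant b) (laurent_cop g) = (laurent_eps g)%:A.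
Proof.
apply: (@laurent_sweedler _ (fun g => (laurent_eps g)%:A)) => [||n].
- split=> [w a u v|v a u w]; last by rewrite laurent_antP mulrDr -scalerAr.
  by rewrite mulrDl -scalerAl.
- exact: laurent_eps_alg_linear.
by rewrite laurent_antU zpowM addrN laurent_epsU scale1r.
Qed.

Lemma laurent_ant_star (g : L) :
  laurent_ant (laurent_star (laurent_ant (laurent_star g))) = g.
Proof.
move: g; apply: (@laurent_ext _ _ idfun) => [a u v|//|n].
  by rewrite !(laurent_star_antilinear, laurent_antP) conjCK.
by do 2!rewrite laurent_starU laurent_antU opprK.
Qed.

Definition U1 : starHopf C := @StarHopf C A (@laurent_cop C) (@laurent_eps C)
  (@laurent_ant C) laurent_cop_morphism laurent_copA (@laurent_epsP C)
  (@laurent_epsU C 0) laurent_epsM laurent_eps_star laurent_eps_cop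
  laurent_cop_eps (@laurent_antP C) laurent_ant_cop laurent_cop_ant
  laurent_ant_star.

Definition U1z : U1 := zpow C 1.

End U1.

Section U1Calculus.
Variable C : numClosedFieldType.
Local Notation H := (U1 C).

Definition scalars : H -> Prop := fun x => exists a : C, x = a%:A.

(* Bicovariant calculi with associated right ideal Ker^2(eps), resp. Ker(eps). *)
Definition classical_calculus (G : fodc H) :=
  bicovariant G /\ forall g : H, right_ideal G g <-> ker_eps2 g.
Definition zero_calculus (G : fodc H) :=
  bicovariant G /\ forall g : H, right_ideal G g <-> eps g = 0.

Variables (Gc : fodc H) (Omega : envelope Gc) (G : fodc H) (W : envelope G).

Definition pi_z : Omega := env_in Omega (ant (U1z C)) * dif (env_in Omega (U1z C)).

(* The formulas defining the coaction on Omega; its values lie in             *)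
(* Omega (x) W, where W is the envelope of G, identified with H by env_in W.  *)
Definition U1_coaction (coact : Omega -> tensor Omega W) :=
  [/\ linear coact,
      forall g : H,
        coact (env_in Omega g) = tmap (env_in Omega) (env_in W) (cop g)
    & forall g : H, coact (env_in Omega g * pi_z) =
        tlift (fun a b : H => (env_in Omega a * pi_z) ⊗ env_in W b) (cop g)].

End U1Calculus.

(* Main.v *)
From HB Require Import structures.
Require Import Defs.
From mathcomp Require Import all_boot all_order all_algebra.
From mathcomp Require Import finmap monalg.
From mathcomp Require Import boolp reals complex.

(** The classical calculus of U(1) is free of rank one on w = z^{-1} dz. Its
    right ideal Ker^2 contains z^n - 1 - n (z - 1), and g |-> S(g1) dg2 kills
    it, so dz^n = n z^n w; expanding d(z z) then shows that w is central.
    Every form is thus g w for some g. If g w = 0, left covariance gives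
    sum_k g_k z^k (x) z^k w = 0, hence g_k w = 0 for each coefficient g_k of g;
    and w <> 0, because the derivative at 1, which sends z^n to n, vanishes on
    Ker^2 but not on z - 1 (classical_logarithmic, omega_central,
    classical_free).

    In degrees 0 and 1 the ideal defining the universal envelope is zero
    (env_ideal_low). The relation z^{-1} dz + z d(z^{-1}) = 0 puts
    dz^{-1} (x) dz + dz (x) dz^{-1} = -2 w (x) w into it, so it contains every
    tensor of degree at least 2 (log_square_zero, env_ideal_high). Hence an
    envelope of the classical calculus is P (+) P w with w w = 0. The calculus
    with right ideal Ker(eps) has dz^n = 0 for all n, hence no nonzero form, and
    its envelope is H. In both cases an envelope exists: it is the square-zero
    extension of the algebra by the bimodule of forms (envelope_exists).

    On the basis z^n, z^n w of Omega(P) the coaction is multiplication by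
    (x) z^n, and its second factor is closed and of degree 0, so that no sign
    occurs; being a morphism of graded differential *-algebras is a
    verification on this basis. A form x with coact x = x (x) 1 is recovered
    from coact x by taking the coefficient of z^0 in the second factor, and this
    operation has values in the span of 1 and w (circle_base_form). Finally, a
    one-form generated by the scalars is a sum of x_0 d(b 1) = 0, whereas
    w <> 0 (circle_base_not_generated). *)

Set Implicit Arguments.
Unset Strict Implicit.
Unset Printing Implicit Defensive.

Import Order.TTheory GRing.Theory Num.Theory.
Local Open Scope ring_scope.

(** * Linear and antilinear maps *)

Lemma lin0 (K : fieldType) (U V : lmodType K) (f : U -> V) :
  linear f -> f 0 = 0.
Proof.
by move=> lf; have := lf (-1) 0 0; rewrite scaler0 addr0 scaleN1r addNr.
Qed.

Lemma linZ (K : fieldType) (U V : lmodType K) (f : U -> V) : linear f ->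
  forall a x, f (a *: x) = a *: f x.
Proof. by move=> lf a x; have := lf a x 0; rewrite (lin0 lf) !addr0. Qed.

Lemma linD (K : fieldType) (U V : lmodType K) (f : U -> V) : linear f ->
  forall x y, f (x + y) = f x + f y.
Proof. by move=> lf x y; have := lf 1 x y; rewrite !scale1r. Qed.

Lemma linN (K : fieldType) (U V : lmodType K) (f : U -> V) : linear f ->
  forall x, f (- x) = - f x.
Proof. by move=> lf x; rewrite -scaleN1r (linZ lf) scaleN1r. Qed.

Lemma lin_sum (K : fieldType) (U V : lmodType K) (f : U -> V) : linear f ->
  forall (I : Type) (s : seq I) (F : I -> U),
  f (\sum_(i <- s) F i) = \sum_(i <- s) f (F i).
Proof.
move=> lf I s F; elim: s => [|i s IH]; first by rewrite !big_nil (lin0 lf).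
by rewrite !big_cons (linD lf) IH.
Qed.

Lemma lin_comb (K : fieldType) (U V : lmodType K) (f g : U -> V) a :
  linear f -> linear g -> linear (fun x => a *: f x + g x).
Proof.
move=> lf lg b x y.
by rewrite lf lg !scalerDr !scalerA [a * b]mulrC addrACA.
Qed.

Lemma lin_comp (K : fieldType) (U V W : lmodType K) (f : V -> W) (g : U -> V) :
  linear f -> linear g -> linear (fun x => f (g x)).
Proof. by move=> lf lg b x y; rewrite lg lf. Qed.

Lemma lin_span (K : fieldType) (U V : lmodType K) (f : U -> V) (S : U -> Prop) :
  linear f -> (forall x, S x -> f x = 0) -> forall x, Defs.span S x -> f x = 0.
Proof.
move=> lf fS x; elim=> [|a u v Su _ IH]; first exact: lin0.
by rewrite lf fS // IH scaler0 addr0.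
Qed.

Lemma span_linP (K : fieldType) (U : lmodType K) (S : U -> Prop) a x y :
  Defs.span S x -> Defs.span S y -> Defs.span S (a *: x + y).
Proof. by move=> Sx Sy; apply: spanD => //; apply: spanZ. Qed.

Lemma lin_add (K : fieldType) (U V : lmodType K) (f1 f2 : U -> V) :
  linear f1 -> linear f2 -> linear (fun x => f1 x + f2 x).
Proof. by move=> l1 l2 a x y; rewrite l1 l2 scalerDr addrACA. Qed.

Lemma antilinear0 (C : numClosedFieldType) (V W : lmodType C) (f : V -> W) :
  antilinear f -> f 0 = 0.
Proof.
move=> lf; have := lf (-1) 0 0.
by rewrite scaler0 addr0 rmorphN1 scaleN1r addNr.
Qed.

Lemma antilinearZ (C : numClosedFieldType) (V W : lmodType C) (f : V -> W) :
  antilinear f -> forall a x, f (a *: x) = a^* *: f x.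
Proof. by move=> lf a x; have := lf a x 0; rewrite (antilinear0 lf) !addr0. Qed.

Lemma antilinearN (C : numClosedFieldType) (V W : lmodType C) (f : V -> W) :
  antilinear f -> forall x, f (- x) = - f x.
Proof.
by move=> lf x; rewrite -scaleN1r (antilinearZ lf) rmorphN1 scaleN1r.
Qed.

Lemma tens_0r (K : fieldType) (V W : lmodType K) (v : V) : v ⊗ (0 : W) = 0.
Proof. by apply: (@lin0 _ _ _ (tens v)) => a x y; exact: tens_linr. Qed.

Lemma tens_0l (K : fieldType) (V W : lmodType K) (w : W) : (0 : V) ⊗ w = 0.
Proof.
by apply: (@lin0 _ _ _ (fun v : V => v ⊗ w)) => a x y; exact: tens_linl.
Qed.

(** * Balanced tensor products and tensor powers *)

Section BalancedTensor.
Variables (C : numClosedFieldType) (A : starAlg C) (G : fodc A).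

(** The maps out of G x T that factor through the tensor product over A. *)
Definition balanced (T : lmodule A) (U : lmodType C) (f : G -> T -> U) :=
  bisemilinear idfun f /\
  forall w h t, f (ract w h) t = f w (lm_act h t).

Section Lift.
Variables (T : lmodule A) (U : lmodType C) (f : G -> T -> U).
Hypothesis bf : balanced f.

Lemma tlift_linear : linear (tlift f).
Proof. by move=> a x y; apply: tliftsP; case: bf. Qed.

Lemma blift_pi x : blift f (lpi (@bal_rel _ _ G T) x) = tlift f x.
Proof.
case: bf => bi bal; apply/eqP; rewrite -subr_eq0 -(linN tlift_linear).
rewrite -(linD tlift_linear); apply/eqP.
apply: (lin_span tlift_linear) (lrepr_span _ _) => _ [w h t].
by rewrite (linD tlift_linear) (linN tlift_linear) !(tliftsE _ _ bi) bal subrr.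
Qed.

Lemma bliftE w t : blift f (bt w t) = f w t.
Proof. by rewrite blift_pi (tliftsE _ _ bf.1). Qed.

Lemma blift_linear : linear (blift f).
Proof.
move=> a; elim/lquotW=> x; elim/lquotW=> y.
by rewrite -lpi_is_linear !blift_pi tlift_linear.
Qed.

End Lift.

Variable T : lmodule A.
Implicit Types (w v : G) (t s : T).

Lemma bt_linl t a w v : bt (a *: w + v) t = a *: bt w t + bt v t.
Proof. by rewrite /bt tens_linl lpi_is_linear. Qed.

Lemma bt_linr w a t s : bt w (a *: t + s) = a *: bt w t + bt w s.
Proof. by rewrite /bt tens_linr lpi_is_linear. Qed.

Lemma bt_bal w h t : bt (ract w h) t = bt w (lm_act h t).
Proof. by apply/lpiP/spanS; exact: BalRel. Qed.

Lemma bt_ind (P : btensor G T -> Prop) : P 0 ->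
  (forall a w t q, P q -> P (a *: bt w t + q)) -> forall q, P q.
Proof.
move=> P0 PS; elim/lquotW; elim/tens_ind=> [//|a v w t IH].
by rewrite lpi_is_linear; apply: PS.
Qed.

Lemma bt_ext (U : lmodType C) (f g : btensor G T -> U) :
  linear f -> linear g -> (forall w t, f (bt w t) = g (bt w t)) -> f =1 g.
Proof.
move=> lf lg fg; elim/bt_ind => [|a w t q IH]; first by rewrite !lin0.
by rewrite lf lg fg IH.
Qed.

End BalancedTensor.

Section TensorPowers.
Variables (C : numClosedFieldType) (A : starAlg C) (G : fodc A).

(** The laws of a left module over A; the tensor powers carry only its action. *)
Definition module_laws (T : lmodule A) :=
  [/\ forall h, linear (@lm_act _ _ T h),
      forall t : T, linear (fun h => lm_act h t),
      forall g h (t : T), lm_act (g * h) t = lm_act g (lm_act h t)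
    & forall t : T, lm_act 1 t = t].

Lemma bt_act_balanced k h :
  balanced (fun (w : G) (t : tpow G k) => bt (lact h w) t).
Proof.
split; last by move=> w g t; rewrite -lract bt_bal.
by split=> *; rewrite ?lact_linr ?bt_linl ?bt_linr.
Qed.

Lemma tpow_actE k h w (t : tpow G k) :
  @lm_act _ _ (tpow G k.+1) h (bt w t) = bt (lact h w) t.
Proof. exact: bliftE (bt_act_balanced k h) w t. Qed.

Lemma tpow_act_linear k h : linear (@lm_act _ _ (tpow G k.+1) h).
Proof. exact: blift_linear (bt_act_balanced k h). Qed.

Lemma tpow_laws k : module_laws (tpow G k).
Proof.
case: k => [|k].
  by split=> [h a x y|t a x y|g h t|t] /=;
    rewrite ?mulrDr ?mulrDl -?scalerAr -?scalerAl ?mulrA ?mul1r.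
pose T := tpow G k.+1.
have act h : linear (@lm_act _ _ T h) by exact: tpow_act_linear.
split=> [h|t a g h|g h t|t]; first exact: act.
- apply: (@bt_ext _ _ _ (tpow G k) T _ _ (act _)
    (lin_comb a (act g) (act h))) => w s.
  by rewrite !tpow_actE lact_linl bt_linl.
- apply: (@bt_ext _ _ _ (tpow G k) T _ _ (act _)
    (lin_comp (act g) (act h))) => w s.
  by rewrite !tpow_actE lactM.
apply: (@bt_ext _ _ _ (tpow G k) T _ id (act 1)) => // w s.
by rewrite tpow_actE lact1.
Qed.

(** Compatibility with the left action is proved together with linearity: it is
    what makes w (x) s |-> w (x) (s t) balanced in the inductive step. *)
Lemma tpow_mul_laws i j :
  [/\ forall s : tpow G i, linear (@tpow_mul _ _ G i j s),
      forall t : tpow G j, linear (fun s : tpow G i => tpow_mul s t)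
    & forall h (s : tpow G i) (t : tpow G j),
        tpow_mul (lm_act h s) t = lm_act h (tpow_mul s t)].
Proof.
elim: i => [|i [IHr IHl IHa]].
  by have [h1 h2 h3 _] := tpow_laws j; split=> *; rewrite /= ?h1 ?h2 ?h3.
have bal (t : tpow G j) : balanced
    (fun w (s : tpow G i) => @bt _ _ G (tpow G _) w (tpow_mul s t)).
  split; last by move=> w h s; rewrite bt_bal IHa.
  by split=> *; rewrite ?bt_linl // IHl bt_linr.
have lin (t : tpow G j) : linear (fun s : tpow G i.+1 => tpow_mul s t).
  exact: blift_linear (bal t).
have val (t : tpow G j) w s :
    @tpow_mul _ _ G i.+1 j (bt w s) t = bt w (tpow_mul s t).
  exact: bliftE (bal t) w s.
pose T := tpow G i.+1; pose U := tpow G (i.+1 + j)%coq_nat.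
split=> [s a x y|//|h s t].
  apply: (@bt_ext _ _ _ (tpow G i) U _ _ (lin _)
    (lin_comb a (lin x) (lin y))) => w u.
  by rewrite !val IHr bt_linr.
apply: (@bt_ext _ _ _ (tpow G i) U _ _
  (lin_comp (lin t) (@tpow_act_linear i h))
  (lin_comp (@tpow_act_linear _ h) (lin t))) => w u.
by rewrite tpow_actE !val tpow_actE.
Qed.

Lemma tpow_mulE i j w (s : tpow G i) (t : tpow G j) :
  @tpow_mul _ _ G i.+1 j (bt w s) t = bt w (tpow_mul s t).
Proof.
have [_ lin act] := tpow_mul_laws i j.
apply: (@bliftE _ _ _ _ _
  (fun w (s : tpow G i) => @bt _ _ G (tpow G _) w (tpow_mul s t))).
split; last by move=> v h u; rewrite bt_bal act.
by split=> *; rewrite ?bt_linl // lin bt_linr.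
Qed.

Lemma tpow_mul0 i j (s : tpow G i) : @tpow_mul _ _ G i j s 0 = 0.
Proof. by have [lr _ _] := tpow_mul_laws i j; exact: lin0. Qed.

Lemma tpow_0mul i j (t : tpow G j) : @tpow_mul _ _ G i j 0 t = 0.
Proof. by have [_ ll _] := tpow_mul_laws i j; exact: (lin0 (ll t)). Qed.

Lemma tpow1_linear : linear (@tpow1 _ _ G).
Proof. by move=> a w v; rewrite /tpow1 bt_linl. Qed.

(** Over A the first tensor power is G itself, through w (x) h = w h (x) 1. *)
Lemma bt_tpow1 w (h : A) : @bt _ _ G (tpow G 0) w h = tpow1 (ract w h).
Proof. by rewrite /tpow1 bt_bal /= mulr1. Qed.

Lemma tpow1_surj (t : tpow G 1) : exists w, t = tpow1 w.
Proof.
move: t; elim/bt_ind=> [|a w h _ [v ->]].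
  by exists 0; rewrite (lin0 tpow1_linear).
by exists (a *: ract w h + v); rewrite tpow1_linear bt_tpow1.
Qed.

(** The isomorphism from the first tensor power to G, with inverse tpow1. *)
Definition tpow1_form : tpow G 1 -> G :=
  @blift _ _ _ (tpow G 0) _ (fun w h => ract w h).

Lemma tpow1_form_balanced : @balanced _ _ G (tpow G 0) _ (fun w h => ract w h).
Proof.
split; last by move=> w g h; rewrite -ractM.
by split=> *; rewrite ?ract_linl ?ract_linr.
Qed.

Lemma tpow1_form_linear : linear tpow1_form.
Proof. exact: blift_linear tpow1_form_balanced. Qed.

Lemma tpow1K w : tpow1_form (tpow1 w) = w.
Proof. by rewrite /tpow1_form (bliftE tpow1_form_balanced) ract1. Qed.

Lemma tpow2_linl v : linear (fun w : G => tpow2 w v).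
Proof. by move=> a w u; rewrite /tpow2 bt_linl. Qed.

Lemma tpow2_linr v : linear (@tpow2 _ _ G v).
Proof. by move=> a w u; rewrite /tpow2 tpow1_linear bt_linr. Qed.

(** Functions can be moved to the far left of a tensor of degree 2, up to the
    action of h on v from the right. *)
Lemma tpow2_act g h v w :
  tpow2 (lact g v) (lact h w) = @tpow_mul _ _ G 0 2 g (tpow2 (ract v h) w).
Proof.
have E : tpow1 (lact h w) = @lm_act _ _ (tpow G 1) h (tpow1 w).
  by rewrite /tpow1 tpow_actE.
rewrite /tpow2 E -bt_bal lract -[RHS]/(lm_act _ _).
by rewrite tpow_actE.
Qed.

(** The generators have degree 2, and the degree of a factor is at most that of
    the product. *)
Lemma env_ideal_low k (t : tpow G k) : env_ideal t -> (k <= 1)%N -> t = 0.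
Proof.
elim=> {k t} [//|//|k a s t _ IHs _ IHt le|i j s t _ IH le|i j s t _ IH le].
- by rewrite IHs // IHt // scaler0 addr0.
- by rewrite IH ?tpow_mul0 //; apply: leq_trans le; exact: leq_addl.
by rewrite IH ?tpow_0mul //; apply: leq_trans le; exact: leq_addr.
Qed.

(** The induction principle of balanced tensor products, stated with the types
    tpow so that module operations stay on tensor powers. *)
Lemma tpow_ind k (P : tpow G k.+1 -> Prop) : P 0 ->
  (forall a w (t : tpow G k) (q : tpow G k.+1), P q ->
     P (a *: (bt w t : tpow G k.+1) + q)) -> forall q, P q.
Proof. exact: bt_ind. Qed.

(** A tensor v (x) w (x) t is the product of v (x) w and t. *)
Lemma env_ideal_high : (forall v w : G, env_ideal (tpow2 v w)) ->
  forall k (t : tpow G k.+2), env_ideal t.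
Proof.
move=> all2 k; elim/tpow_ind=> [|a v q r]; first exact: env_0.
apply: env_lin; pose F : tpow G k.+1 -> tpow G k.+2 := @bt _ _ G (tpow G k.+1) v.
have bl : linear F by move=> *; exact: bt_linr.
rewrite -[bt _ _]/(F q); elim/tpow_ind: q => [|b w t q IH].
  by rewrite (lin0 bl); exact: env_0.
rewrite bl; apply: env_lin; last exact: IH.
suff -> : F (@bt _ _ G (tpow G k) w t) =
    @tpow_mul _ _ G 2 k (tpow2 v w) t.
  exact: (@env_mulr _ _ _ 2 k _ t (all2 v w)).
by rewrite /F /tpow2 /tpow1 !tpow_mulE; have [_ _ _ /= ->] := tpow_laws k.
Qed.

End TensorPowers.

(** * Universal envelopes *)

Lemma homog_lin (C : numClosedFieldType) (W : gdsa C) k a (x y : W) :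
  homog k x -> homog k y -> homog k (a *: x + y).
Proof. by move=> hx hy; rewrite /homog hcomp_linear hx hy. Qed.

Lemma homog0 (C : numClosedFieldType) (W : gdsa C) k : homog k (0 : W).
Proof. exact: lin0 (@hcomp_linear C W k). Qed.

(** Each factor dx has degree 1, and the number of these factors is k. *)
Lemma gen_deg_homog (C : numClosedFieldType) (W : gdsa C) (X : W -> Prop) k w :
  (forall x, X x -> homog 0 x) -> gen_deg X k w -> homog k w.
Proof.
move=> hX; elim=> [|a x y [x0 [s [X0 Xs <- ->]]] _ IH]; first exact: homog0.
apply: homog_lin IH; rewrite -[size s]add0n; apply: homM; first exact: hX.
elim: s Xs => [|u s IH] Xs; first by rewrite big_nil; exact: hom1.
rewrite big_cons -[size _]add1n; apply: homM.
  by apply/dif_hom/hX/Xs; rewrite mem_head.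
by apply: IH => v sv; apply: Xs; rewrite inE sv orbT.
Qed.

(** By env_ideal_low and env_ideal_high, the envelope is then concentrated in
    degrees 0 and 1, where it is A and G. *)
Definition square_zero (C : numClosedFieldType) (A : starAlg C) (G : fodc A) :=
  forall v w : G, env_ideal (tpow2 v w).

Section EnvelopeTheory.
Variables (C : numClosedFieldType) (A : starAlg C) (G : fodc A) (W : envelope G).
Implicit Types (g h : A) (v w : G) (x y : W).

(** The embedding of the one-forms in the envelope, as env_in is that of A. *)
Definition env_form (w : G) : W := env_pi W (tpow1 w).

Lemma env_in_linear : linear (env_in W).
Proof. exact: (@env_pi_linear _ _ _ W 0). Qed.

Lemma env_form_linear : linear env_form.
Proof. by move=> a v w; rewrite /env_form tpow1_linear env_pi_linear. Qed.

Lemma env_in1 : env_in W 1 = 1. Proof. exact: env_pi1. Qed.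

Lemma env_inM g h : env_in W (g * h) = env_in W g * env_in W h.
Proof. exact: (@env_piM _ _ _ W 0 0). Qed.

Lemma env_in_alg (a : C) : env_in W a%:A = a%:A.
Proof. by rewrite (linZ env_in_linear) env_in1. Qed.

Lemma env_in_star g : gstar (env_in W g) = env_in W (star g).
Proof. exact: env_star0. Qed.

Lemma env_in_dif g : dif (env_in W g) = env_form (dif1 G g).
Proof. exact: env_dif. Qed.

Lemma env_form_star w : gstar (env_form w) = env_form (star1 w).
Proof. exact: env_star1. Qed.

Lemma env_in_eq0 g : env_in W g = 0 -> g = 0.
Proof. by move/env_pi_ker/env_ideal_low; apply. Qed.

Lemma env_form_eq0 w : env_form w = 0 -> w = 0.
Proof.
move/env_pi_ker/env_ideal_low => /(_ isT) e.
by rewrite -[w]tpow1K e (lin0 (@tpow1_form_linear _ _ _)).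
Qed.

Lemma env_in_inj : injective (env_in W).
Proof.
move=> g h e; apply/eqP; rewrite -subr_eq0; apply/eqP/env_in_eq0.
by rewrite (linD env_in_linear) (linN env_in_linear) e subrr.
Qed.

Lemma env_lactE g w : env_in W g * env_form w = env_form (lact g w).
Proof.
rewrite /env_in /env_form -(@env_piM _ _ _ W 0 1) -[tpow_mul _ _]/(lm_act _ _).
by rewrite /tpow1 tpow_actE.
Qed.

Lemma env_ractE w g : env_form w * env_in W g = env_form (ract w g).
Proof.
rewrite /env_in /env_form -(@env_piM _ _ _ W 1 0) /tpow1 tpow_mulE /=.
by rewrite mul1r -[RHS]/(env_form _) /env_form -bt_tpow1.
Qed.

Lemma env_formM v w : env_form v * env_form w = env_pi W (tpow2 v w).
Proof.
rewrite /env_form -(@env_piM _ _ _ W 1 1) /tpow1 tpow_mulE.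
by rewrite -[tpow_mul _ _]/(lm_act _ _) tpow_actE lact1.
Qed.

Lemma homog_env_in x : homog 0 x <-> exists g, x = env_in W g.
Proof. exact: env_pi_hom. Qed.

Lemma homog_env_form x : homog 1 x <-> exists w, x = env_form w.
Proof.
split=> [/env_pi_hom [t ->]|[w ->]]; last by apply/env_pi_hom; exists (tpow1 w).
by have [w ->] := tpow1_surj t; exists w.
Qed.

Lemma env_degree0 : degree0 (env_in W).
Proof.
split; [split; [exact: env_in_linear|exact: env_in_inj]|exact: env_in1
  |exact: env_inM|by move=> g; rewrite env_in_star|exact: homog_env_in].
Qed.

Hypothesis G2 : square_zero G.

Lemma homog_ge2 k x : homog k.+2 x -> x = 0.
Proof. by move/env_pi_hom=> [t ->]; apply/env_pi_ker/env_ideal_high. Qed.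

Lemma env_formM0 v w : env_form v * env_form w = 0.
Proof. by rewrite env_formM; apply/env_pi_ker/G2. Qed.

Lemma env_form_dif w : dif (env_form w) = 0.
Proof. by apply: (@homog_ge2 0); apply/dif_hom/homog_env_form; exists w. Qed.

(** The components of degree at least 2 vanish, and the others are given by
    homog_env_in and homog_env_form. *)
Lemma env_decomp x : exists g w, x = env_in W g + env_form w.
Proof.
have hh k : homog k (hcomp k x) by rewrite /homog hcomp_proj eqxx.
have [g eg] := (homog_env_in _).1 (hh 0).
have [w ew] := (homog_env_form _).1 (hh 1).
exists g, w; rewrite -eg -ew.
have [n [n0 en]] := hcomp_fin x.
have high k : hcomp k.+2 x = 0 by apply: (@homog_ge2 k); exact: hh.
case: n n0 en => [|[|n]] n0 ->.
- by rewrite big_ord0 !(lin0 (@hcomp_linear _ _ _)) addr0.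
- by rewrite big_ord1 !hcomp_proj addr0.
rewrite !big_ord_recl big1 ?addr0; last by move=> i _; exact: high.
by rewrite !(linD (@hcomp_linear _ _ _)) !hcomp_proj /= addr0 add0r.
Qed.

Lemma env_decomp_inj g h v w :
  env_in W g + env_form v = env_in W h + env_form w -> g = h /\ v = w.
Proof.
have lc k := @hcomp_linear C W k.
have h0 u : homog 0 (env_in W u) by apply/homog_env_in; exists u.
have h1 u : homog 1 (env_form u) by apply/homog_env_form; exists u.
move=> e; split.
  move/(congr1 (hcomp 0)): e; rewrite !(linD (lc 0)) !(hcomp_hom _ (h0 _)).
  by rewrite !(hcomp_hom _ (h1 _)) /= !addr0 => /env_in_inj.
move/(congr1 (hcomp 1)): e; rewrite !(linD (lc 1)) !(hcomp_hom _ (h0 _)).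
rewrite !(hcomp_hom _ (h1 _)) /= !add0r => /eqP; rewrite -subr_eq0.
rewrite -(linN env_form_linear) -(linD env_form_linear) => /eqP/env_form_eq0.
by move/eqP; rewrite subr_eq0 => /eqP.
Qed.

(** In degree 1 this is the axiom that G is spanned by the forms g dh. *)
Lemma env_generated :
  generated_by (fun=> True) (fun x : W => exists g, x = env_in W g).
Proof.
move=> k x; split=> [[_ hx]|hx]; last first.
  by split=> //; apply: gen_deg_homog hx => y /homog_env_in.
case: k hx => [|[|k]] hx.
- have [g ->] := (homog_env_in _).1 hx.
  apply: spanS; exists (env_in W g), [::]; split=> //; first by exists g.
  by rewrite big_nil mulr1.
- have [w ->] := (homog_env_form _).1 hx.
  have := form1_span w; elim=> [|a u v [g [h ->]] _ IH].
    by rewrite (lin0 env_form_linear); exact: span0.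
  rewrite env_form_linear; apply: span_linP IH; apply: spanS.
  exists (env_in W g), [:: env_in W h]; split=> //; first by exists g.
    by move=> y; rewrite inE => /eqP ->; exists h.
  by rewrite big_seq1 env_in_dif env_lactE.
by rewrite (homog_ge2 hx); exact: span0.
Qed.

End EnvelopeTheory.

(** * The square-zero extension as an envelope *)

Section SquareZeroExtension.
Variables (C : numClosedFieldType) (A : starAlg C) (G : fodc A).

(** The algebra A (+) G in which the product of two one-forms is zero. *)
Definition sqz := (A * G)%type.
HB.instance Definition _ := GRing.Lmodule.on sqz.
Implicit Types x y z : sqz.

Definition sqz_mul x y : sqz := (x.1 * y.1, ract x.2 y.1 + lact x.1 y.2).

Lemma lactD (g : A) (v w : G) : lact g (v + w) = lact g v + lact g w.
Proof. exact: (linD (lact_linr g)). Qed.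
Lemma ractD (g : A) (v w : G) : ract (v + w) g = ract v g + ract w g.
Proof. exact: (linD (ract_linl g)). Qed.
Lemma lactDl (g h : A) (w : G) : lact (g + h) w = lact g w + lact h w.
Proof. exact: (linD (lact_linl w)). Qed.
Lemma ractDr (g h : A) (w : G) : ract w (g + h) = ract w g + ract w h.
Proof. exact: (linD (ract_linr w)). Qed.
Lemma lact0 (g : A) : lact g (0 : G) = 0.
Proof. exact: (lin0 (lact_linr g)). Qed.
Lemma ract0 (g : A) : ract (0 : G) g = 0.
Proof. exact: (lin0 (ract_linl g)). Qed.
Lemma lact0l (w : G) : lact 0 w = 0.
Proof. exact: (lin0 (lact_linl w)). Qed.
Lemma ract0r (w : G) : ract w 0 = 0.
Proof. exact: (lin0 (ract_linr w)). Qed.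

Fact sqz_mulA : associative sqz_mul.
Proof.
move=> x y z; congr (_, _) => /=; first by rewrite mulrA.
by rewrite ractM lactM ractD lactD lract addrA.
Qed.
Fact sqz_mul1 : left_id ((1, 0) : sqz) sqz_mul.
Proof. by case=> a w; congr (_, _); rewrite /= ?mul1r // ract0 lact1 add0r. Qed.
Fact sqz_1mul : right_id ((1, 0) : sqz) sqz_mul.
Proof. by case=> a w; congr (_, _); rewrite /= ?mulr1 // lact0 ract1 addr0. Qed.
Fact sqz_mulDl : left_distributive sqz_mul +%R.
Proof.
move=> x y z; congr (_, _); first exact: mulrDl.
by rewrite /= ractD lactDl addrACA.
Qed.
Fact sqz_mulDr : right_distributive sqz_mul +%R.
Proof.
move=> x y z; congr (_, _); first exact: mulrDr.
by rewrite /= lactD ractDr addrACA.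
Qed.
Fact sqz_1_neq0 : ((1, 0) : sqz) != 0.
Proof. by apply/eqP=> /(congr1 fst) /= /eqP; rewrite oner_eq0. Qed.

HB.instance Definition _ := GRing.Zmodule_isNzRing.Build sqz
  sqz_mulA sqz_mul1 sqz_1mul sqz_mulDl sqz_mulDr sqz_1_neq0.

Fact sqz_scaleAl a x y : a *: (x * y) = a *: x * y.
Proof.
congr (_, _) => /=; first exact: scalerAl.
by rewrite scalerDr (linZ (ract_linl _)) (linZ (lact_linl _)).
Qed.
HB.instance Definition _ := GRing.Lmodule_isLalgebra.Build C sqz sqz_scaleAl.
Fact sqz_scaleAr a x y : a *: (x * y) = x * (a *: y).
Proof.
congr (_, _) => /=; first exact: scalerAr.
by rewrite scalerDr (linZ (ract_linr _)) (linZ (lact_linr _)).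
Qed.
HB.instance Definition _ := GRing.Lalgebra_isAlgebra.Build C sqz sqz_scaleAr.

Definition sqz_hcomp (k : nat) x : sqz :=
  match k with 0 => (x.1, 0) | 1 => (0, x.2) | _ => 0 end.
Definition sqz_dif x : sqz := (0, dif1 G x.1).
Definition sqz_star x : sqz := (star x.1, star1 x.2).

Lemma star_0 : star (0 : A) = 0.
Proof. exact: antilinear0 (@star_antilinear C A). Qed.

Lemma star1_0 : star1 (0 : G) = 0.
Proof. exact: antilinear0 (@star1_antilinear C A G). Qed.

Lemma star1_ract (w : G) g : star1 (ract w g) = lact (star g) (star1 w).
Proof. by apply: (can_inj (@star1K _ _ G)); rewrite star1K star1_lact star1K starK. Qed.

Lemma sqz_hom0 x : sqz_hcomp 0 x = x -> x.2 = 0.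
Proof. by move=> <-. Qed.
Lemma sqz_hom1 x : sqz_hcomp 1 x = x -> x.1 = 0.
Proof. by move=> <-. Qed.
Lemma sqz_hom2 k x : sqz_hcomp k.+2 x = x -> x = 0.
Proof. by move=> <-. Qed.

Fact sqz_hcomp_linear k : linear (sqz_hcomp k).
Proof.
by case: k => [|[|k]] a x y; rewrite ?scaler0 ?addr0 //; congr (_, _);
  rewrite /= ?scaler0 ?addr0.
Qed.
Fact sqz_hcomp_proj i j x :
  sqz_hcomp i (sqz_hcomp j x) = if i == j then sqz_hcomp j x else 0.
Proof. by case: i => [|[|i]]; case: j => [|[|j]] //=; case: ifP. Qed.
Fact sqz_hcomp_fin x : exists n, (forall k, (n <= k)%N -> sqz_hcomp k x = 0) /\
  x = \sum_(k < n) sqz_hcomp k x.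
Proof.
exists 2%N; split; first by case=> [|[|k]].
rewrite !big_ord_recl big_ord0 /= addr0.
by case: x => a w; congr (_, _); rewrite /= ?addr0 ?add0r.
Qed.
Fact sqz_homM i j x y : sqz_hcomp i x = x -> sqz_hcomp j y = y ->
  sqz_hcomp (i + j) (x * y) = x * y.
Proof.
case: i => [|[|i]].
- move=> /sqz_hom0 x2; case: j => [|[|j]].
  + by move=> /sqz_hom0 y2; congr (_, _); rewrite x2 y2 ract0 lact0 addr0.
  + by move=> /sqz_hom1 y1; congr (_, _); rewrite /= y1 mulr0.
  + by move=> /sqz_hom2 ->; rewrite mulr0.
- move=> /sqz_hom1 x1; case: j => [|[|j]].
  + by move=> _; congr (_, _); rewrite /= x1 mul0r.
  + move=> /sqz_hom1 y1; symmetry; congr (_, _); rewrite /= x1 y1 ?mul0r //.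
    by rewrite ract0r lact0l addr0.
  + by move=> /sqz_hom2 ->; rewrite mulr0.
by move=> /sqz_hom2 ->; rewrite mul0r.
Qed.
Fact sqz_dif_linear : linear sqz_dif.
Proof.
move=> a x y; congr (_, _) => /=; first by rewrite scaler0 addr0.
exact: dif1_linear.
Qed.
Lemma dif1_0 : dif1 G 0 = 0. Proof. exact: lin0 (dif1_linear G). Qed.
Fact sqz_dif_hom k x : sqz_hcomp k x = x -> sqz_hcomp k.+1 (sqz_dif x) = sqz_dif x.
Proof.
case: k => [//|[|k]]; last by move/sqz_hom2=> ->; rewrite /sqz_dif dif1_0.
by move/sqz_hom1=> x1; rewrite /sqz_dif x1 dif1_0.
Qed.
Fact sqz_difK x : sqz_dif (sqz_dif x) = 0.
Proof. by rewrite /sqz_dif dif1_0. Qed.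
Fact sqz_difM k x y : sqz_hcomp k x = x ->
  sqz_dif (x * y) = sqz_dif x * y + (-1) ^+ k *: (x * sqz_dif y).
Proof.
case: k => [|[|k]].
- move=> _; rewrite expr0 scale1r; congr (_, _) => /=.
    by rewrite mul0r mulr0 addr0.
  by rewrite dif1M lact0l addr0 ract0r add0r.
- move=> /sqz_hom1 x1; congr (_, _) => /=.
    by rewrite mul0r mulr0 scaler0 addr0.
  by rewrite x1 mul0r dif1_0 !lact0l ract0 ract0r !addr0 scaler0 addr0.
move=> /sqz_hom2 ->; rewrite !mul0r scaler0 addr0.
by rewrite (lin0 sqz_dif_linear) mul0r.
Qed.
Fact sqz_star_antilinear : antilinear sqz_star.
Proof.
by move=> a x y; congr (_, _); rewrite /= ?star_antilinear ?star1_antilinear.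
Qed.
Lemma sqz_star0 : sqz_star 0 = 0.
Proof. by rewrite /sqz_star star_0 star1_0. Qed.
Fact sqz_star_hom k x : sqz_hcomp k x = x -> sqz_hcomp k (sqz_star x) = sqz_star x.
Proof.
case: k => [|[|k]].
- by move=> /sqz_hom0 x2; rewrite /sqz_star x2 star1_0.
- by move=> /sqz_hom1 x1; rewrite /sqz_star x1 star_0.
by move=> /sqz_hom2 ->; rewrite sqz_star0.
Qed.
Fact sqz_starK : involutive sqz_star.
Proof. by case=> a w; congr (_, _); rewrite /= ?starK ?star1K. Qed.
Fact sqz_starM i j x y : sqz_hcomp i x = x -> sqz_hcomp j y = y ->
  sqz_star (x * y) = (-1) ^+ (i * j) *: (sqz_star y * sqz_star x).
Proof.
have star1D (v w : G) : star1 (v + w) = star1 v + star1 w.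
  by have := star1_antilinear 1 v w; rewrite rmorph1 !scale1r.
have gen : ract (star1 y.2) (star x.1) + lact (star y.1) (star1 x.2) =
    star1 (ract x.2 y.1 + lact x.1 y.2).
  by rewrite star1D star1_ract star1_lact addrC.
case: i => [|[|i]].
- move=> _ _; rewrite mul0n expr0 scale1r.
  by congr (_, _) => //=; rewrite starM.
- move=> /sqz_hom1 x1; case: j => [|[|j]].
  + move=> _; rewrite muln0 expr0 scale1r.
    by congr (_, _) => //=; rewrite starM.
  + move=> /sqz_hom1 y1; congr (_, _) => /=.
      by rewrite x1 mul0r star_0 mulr0 scaler0.
    by rewrite gen x1 y1 lact0l ract0r addr0 star1_0 scaler0.
  + by move=> /sqz_hom2 ->; rewrite mulr0 !sqz_star0 mul0r scaler0.
by move=> /sqz_hom2 ->; rewrite mul0r !sqz_star0 mulr0 scaler0.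
Qed.
Fact sqz_star_dif x : sqz_star (sqz_dif x) = sqz_dif (sqz_star x).
Proof. by congr (_, _); rewrite /= ?star_0 ?star1_dif. Qed.

Definition sqz_gdsa : gdsa C := @Gdsa C sqz sqz_hcomp sqz_dif sqz_star
  sqz_hcomp_linear sqz_hcomp_proj sqz_hcomp_fin (erefl _) sqz_homM
  sqz_dif_linear sqz_dif_hom sqz_difK sqz_difM sqz_star_antilinear
  sqz_star_hom sqz_starK sqz_starM sqz_star_dif.

(** The projection of the tensor algebra: the identity on A and G, and zero in
    degree at least 2. *)
Definition sqz_pi (k : nat) : tpow G k -> sqz_gdsa :=
  match k with
  | 0 => fun h => ((h : A), 0)
  | 1 => fun t => (0, tpow1_form t)
  | _ => fun=> 0
  end.

Fact sqz_pi_linear k : linear (@sqz_pi k).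
Proof.
case: k => [|[|k]] a x y; last by rewrite scaler0 addr0.
  by congr (_, _); rewrite /= ?scaler0 ?addr0.
congr (_, _); first by rewrite /= ?scaler0 ?addr0.
exact: tpow1_form_linear.
Qed.
Fact sqz_pi_hom k w : homog k w <-> exists t : tpow G k, w = sqz_pi t.
Proof.
split; last by case=> t ->; case: k t => [|[|k]].
case: k => [|[|k]].
- by case: w => a w /sqz_hom0 /= ->; exists a.
- by case: w => a w /sqz_hom1 /= ->; exists (tpow1 w); rewrite /= tpow1K.
by move=> /(@sqz_hom2 k) ->; exists 0.
Qed.
Fact sqz_pi1 : @sqz_pi 0 1 = 1. Proof. by []. Qed.

Lemma tpow1_form_act h (t : tpow G 1) :
  tpow1_form (lm_act h t) = lact h (tpow1_form t).
Proof.
have [v ->] := tpow1_surj t; have [h1 h2 h3 h4] := @tpow_laws C A G 1.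
by rewrite /tpow1 tpow_actE -/(tpow1 _) !tpow1K.
Qed.

Lemma tpow1_form_mul (s : tpow G 1) h :
  tpow1_form (@tpow_mul _ _ G 1 0 s h) = ract (tpow1_form s) h.
Proof.
have [v ->] := tpow1_surj s.
by rewrite tpow1K /tpow1 tpow_mulE /= mul1r bt_tpow1 tpow1K.
Qed.

Fact sqz_piM i j (s : tpow G i) (t : tpow G j) :
  sqz_pi (tpow_mul s t) = sqz_pi s * sqz_pi t.
Proof.
case: i s => [|[|i]] s; last by rewrite mul0r.
- case: j t => [|[|j]] t; last by rewrite mulr0.
    by congr (_, _); rewrite /= ract0 lact0 addr0.
  congr (_, _); first by rewrite /= mulr0.
  by rewrite /= ract0 add0r -tpow1_form_act.
case: j t => [|[|j]] t; last by rewrite mulr0.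
  congr (_, _); first by rewrite /= mul0r.
  by rewrite -[RHS]/(ract _ _ + lact _ _) lact0 addr0 -tpow1_form_mul.
by symmetry; congr (_, _); rewrite /= ?mulr0 // ract0r lact0l addr0.
Qed.

(** Injectivity in degrees 0 and 1 matches env_ideal_low, and the vanishing in
    higher degree matches env_ideal_high. *)
Fact sqz_pi_ker : square_zero G ->
  forall k (t : tpow G k), sqz_pi t = 0 <-> env_ideal t.
Proof.
move=> G2 k t; split=> [|it].
  case: k t => [|[|k]] t; last by move=> _; exact: env_ideal_high.
    by move/(congr1 fst) => /= ->; exact: env_0.
  have [w ->] := tpow1_surj t.
  move/(congr1 snd); rewrite /= tpow1K => ->.
  by rewrite (lin0 (@tpow1_linear _ _ G)); exact: env_0.
case: k t it => [|[|k]] t // /env_ideal_low /(_ isT) ->.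
  by [].
exact: (lin0 (@sqz_pi_linear 1)).
Qed.

Lemma envelope_exists : square_zero G -> inhabited (envelope G).
Proof.
move=> G2; have dif_in (g : A) :
    dif (@sqz_pi 0 g) = @sqz_pi 1 (tpow1 (dif1 G g)).
  by rewrite /= tpow1K.
have star_form (w : G) :
    gstar (@sqz_pi 1 (tpow1 w)) = @sqz_pi 1 (tpow1 (star1 w)).
  by rewrite /= !tpow1K /sqz_star star_0.
have star_in (g : A) : gstar (@sqz_pi 0 g) = @sqz_pi 0 (star g).
  by rewrite /= /sqz_star star1_0.
exact: (inhabits (@Envelope _ _ _ sqz_gdsa sqz_pi sqz_pi_linear sqz_pi_hom
  (sqz_pi_ker G2) sqz_pi1 sqz_piM dif_in star_in star_form)).
Qed.

End SquareZeroExtension.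

(** * Laurent polynomials and the ideal Ker^2 *)

(** The power z^n as an element of the Hopf algebra. It is locked because
    comparing two distinct unfolded powers by conversion is very slow. *)
HB.lock Definition zp (C : numClosedFieldType) (n : int) : U1 C := zpow C n.

Section CircleAlgebra.
Variable C : numClosedFieldType.
Local Notation H := (U1 C).
Local Notation zp := (zp C).
Implicit Types (m n k : int) (g h : H).

Lemma zpM m n : zp m * zp n = zp (m + n).
Proof. rewrite zp.unlock; exact: zpowM. Qed.

Lemma zp0 : zp 0 = 1.
Proof. by rewrite zp.unlock. Qed.

Lemma zp_star n : star (zp n) = zp (- n).
Proof. rewrite zp.unlock; exact: laurent_starU. Qed.

Lemma zp_cop n : cop (zp n) = zp n ⊗ zp n.
Proof. rewrite zp.unlock; exact: laurent_copU. Qed.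

Lemma zp_eps n : eps (zp n) = 1.
Proof. rewrite zp.unlock; exact: laurent_epsU. Qed.

Lemma zp_ant n : ant (zp n) = zp (- n).
Proof. rewrite zp.unlock; exact: laurent_antU. Qed.

Lemma cop_linear : linear (@cop C H).
Proof. exact: laurent_copP. Qed.

Lemma zp_ext (U : lmodType C) (s : {rmorphism C -> C}) (f g : H -> U) :
  (forall a x y, f (a *: x + y) = s a *: f x + f y) ->
  (forall a x y, g (a *: x + y) = s a *: g x + g y) ->
  (forall n, f (zp n) = g (zp n)) -> f =1 g.
Proof. rewrite zp.unlock; exact: laurent_ext. Qed.

Lemma zp_lin_ext (U : lmodType C) (f g : H -> U) : linear f -> linear g ->
  (forall n, f (zp n) = g (zp n)) -> f =1 g.
Proof. rewrite zp.unlock; exact: (@laurent_ext _ _ idfun). Qed.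

Lemma zp_ind (P : H -> Prop) : P 0 ->
  (forall a n x, P x -> P (a *: zp n + x)) -> forall x, P x.
Proof. rewrite zp.unlock; exact: laurent_ind. Qed.

(** The linear map sending z^n to f n. *)
Definition zext (U : lmodType C) (f : int -> U) : H -> U := lext idfun f.

Lemma zext_linear (U : lmodType C) (f : int -> U) : linear (zext f).
Proof. exact: lextP. Qed.

Lemma zextE (U : lmodType C) (f : int -> U) n : zext f (zp n) = f n.
Proof. rewrite zp.unlock; exact: lextU. Qed.

Definition zcoef k : H -> C^o := fun g => (g : laurent C)@_k.

Lemma zcoef_linear k : linear (zcoef k).
Proof. by move=> a x y; rewrite /zcoef mcoeffD mcoeffZ. Qed.

Lemma zcoefE k n : zcoef k (zp n) = (n == k)%:R.
Proof. rewrite zp.unlock; exact: mcoeffU. Qed.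

Lemma zcoef_eq0 g : (forall k, zcoef k g = 0) -> g = 0.
Proof. by move=> h; apply/malgP => k; rewrite mcoeff0; exact: h. Qed.

Lemma mulr_linear_l h : linear (fun g : H => g * h).
Proof. by move=> a x y; rewrite mulrDl scalerAl. Qed.

Lemma mulr_linear_r g : linear (fun h : H => g * h).
Proof. by move=> a x y; rewrite mulrDr scalerAr. Qed.

(** The derivative z d/dz evaluated at z = 1. *)
Definition zder : H -> C^o := zext (fun n => n%:~R).

Lemma zder_linear : linear zder. Proof. exact: zext_linear. Qed.
Lemma zderE n : zder (zp n) = n%:~R. Proof. exact: zextE. Qed.

Lemma epsP : linear (@eps C H : H -> C^o).
Proof. exact: laurent_epsP. Qed.

Lemma zderM g h : zder (g * h) = eps h *: zder g + eps g *: zder h.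
Proof.
have scl (x : C^o) : linear (fun g : H => eps g *: x : C^o).
  by move=> a u v; rewrite (epsP a u v) scalerDl scalerA.
have scr (c : C) : linear (fun g : H => c *: zder g).
  by move=> a u v; rewrite zder_linear scalerDr !scalerA [c * a]mulrC.
move: g; apply: (zp_lin_ext (lin_comp zder_linear (mulr_linear_l h))
  (lin_add (scr _) (scl _))) => m.
move: h; apply: (zp_lin_ext (lin_comp zder_linear (mulr_linear_r _))
  (lin_add (scl _) (scr _))) => n.
by rewrite zpM !zderE !zp_eps !scale1r -intrD.
Qed.

Lemma lin_scal (U : lmodType C) (f : H -> C^o) (v : U) :
  linear f -> linear (fun x => f x *: v).
Proof. by move=> lf a x y; rewrite lf scalerDl scalerA. Qed.

(** The Leibniz rule zderM gives one direction. For the other, g is congruent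
    to eps(g) 1 + zder(g) (z - 1) modulo Ker^2: by linearity this reduces to
    z^n - 1 - n (z - 1), and increasing n by 1 adds (z^n - 1) (z - 1) to it. *)
Lemma ker_eps2P g : ker_eps2 g <-> eps g = 0 /\ zder g = 0.
Proof.
split.
  have step (f : H -> C^o) : linear f ->
      (forall a b : H, eps a = 0 -> eps b = 0 -> f (a * b) = 0) ->
      ker_eps2 g -> f g = 0.
    move=> lf f0; apply: (lin_span lf) => _ [a [b [ea eb ->]]].
    exact: f0.
  move=> kg; split.
    apply: (step _ epsP) kg => a b ea eb.
    by rewrite epsM ea mul0r.
  apply: (step _ zder_linear) kg => a b ea eb.
  by rewrite zderM ea eb !scale0r addr0.
pose z1 : H := zp 1 - zp 0.
(* The remainder g - eps(g) 1 - zder(g) (z - 1), in a form that is visibly a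
   linear combination of linear maps. *)
pose F (g : H) : H := (-1) *: (zder g *: z1) + ((-1) *: (eps g *: zp 0) + g).
have lF : linear F.
  by apply: lin_comb; [|apply: lin_comb => //]; apply: lin_scal;
    [exact: zder_linear|exact: epsP].
have FE x : F x = x - eps x *: zp 0 - zder x *: z1.
  by rewrite /F !scaleN1r addrC [_ + x]addrC.
suff kF x : ker_eps2 (F x).
  by move=> [e0 d0]; move: (kF g); rewrite FE e0 d0 !scale0r !subr0.
have e1 n : eps (zp n - zp 0) = 0.
  by rewrite -[eps _]/((@eps C H : H -> C^o) _) (linD epsP) (linN epsP) !zp_eps subrr.
have alg (a b c p q : H) : a - p - (c + q) = b - p - c + (a - b - q).
  rewrite -[in LHS](subrK b a) opprD addrA [RHS]addrC !addrA.
  by do 3 (rewrite [LHS]addrAC; congr (_ + _)).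
have kz n : ker_eps2 (F (zp n)).
  have FS m : F (zp (m + 1)) = F (zp m) + (zp m - zp 0) * z1.
    rewrite !FE !zp_eps !zderE intrD scalerDl !scale1r.
    have E : zp m * z1 = zp (m + 1) - zp m by rewrite /z1 mulrBr zpM zp0 mulr1.
    rewrite mulrBl E zp0 mul1r; exact: alg.
  have kS m : ker_eps2 ((zp m - zp 0) * z1).
    apply: spanS; exists (zp m - zp 0), z1; split=> //; exact: e1.
  elim/int_ind: n => [|n IH|n IH].
  - rewrite FE zp_eps zderE scale1r subrr (_ : _%:~R = 0) // scale0r subrr.
    exact: span0.
  - by rewrite -addn1 PoszD FS; apply: spanD; [exact: IH|exact: kS].
  have := FS (- n.+1%:Z); rewrite -addn1 PoszD opprD subrK => E.
  rewrite -(addrK ((zp (- n%:Z - 1) - zp 0) * z1) (F _)) -E.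
  by apply: spanD; [exact: IH|apply: spanN; exact: kS].
elim/zp_ind: x => [|a n x IH]; first by rewrite (lin0 lF); exact: span0.
by rewrite lF; apply: span_linP; [exact: kz|exact: IH].
Qed.

End CircleAlgebra.

(** * First order calculi on the circle *)

(** Used for the images x, y, u of z^n, 1 and z under g |-> S(g1) dg2. *)
Lemma lincomb_eq0 (K : fieldType) (V : lmodType K) (x y u : V) a :
  x - y - a *: (u - y) = 0 -> y = 0 -> x = a *: u.
Proof. by move=> + y0; rewrite y0 !subr0 => /eqP; rewrite subr_eq0 => /eqP. Qed.

Section CircleCalculus.
Variables (C : numClosedFieldType) (G : fodc (U1 C)).
Local Notation H := (U1 C).
Local Notation zp := (zp C).
Implicit Types (m n k : int) (g h : H) (v w : G).

Lemma lcoact_bi0 (a b : H) :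
  bisemilinear idfun (fun c e : H => (a * c) ⊗ lact b (dif1 G e)).
Proof.
by split=> *; rewrite ?mulrDr -?scalerAr ?dif1_linear ?lact_linr
  ?tens_linl ?tens_linr.
Qed.

Lemma lcoact_bi h : bisemilinear idfun (fun a b : H =>
  tlift (fun c e : H => (a * c) ⊗ lact b (dif1 G e)) (cop h)).
Proof.
split=> u c v w; (apply: tlifts_lin => [|||y z]; try exact: lcoact_bi0).
  by rewrite mulrDl -scalerAl tens_linl.
by rewrite lact_linl tens_linr.
Qed.

Lemma lcoact_linear_l h : linear (fun g => lcoact G g h).
Proof. by move=> a x y; rewrite /lcoact cop_linear (tliftsP _ _ _ (lcoact_bi h)). Qed.

Lemma lcoact_linear_r g : linear (lcoact G g).
Proof.
move=> a x y; apply: tlifts_lin => [|||b c]; try exact: lcoact_bi.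
by rewrite cop_linear (tliftsP _ _ _ (lcoact_bi0 b c)).
Qed.

Lemma lcoactE m n :
  lcoact G (zp m) (zp n) = zp (m + n) ⊗ lact (zp m) (dif1 G (zp n)).
Proof.
rewrite /lcoact [cop (zp m)]zp_cop (tliftsE _ _ (lcoact_bi _)) zp_cop.
by rewrite (tliftsE _ _ (lcoact_bi0 _ _)) zpM.
Qed.

Lemma rcoact_bi0 (a b : H) :
  bisemilinear idfun (fun c e : H => lact a (dif1 G c) ⊗ (b * e)).
Proof.
by split=> *; rewrite ?mulrDr -?scalerAr ?dif1_linear ?lact_linr
  ?tens_linl ?tens_linr.
Qed.

Lemma rcoact_bi h : bisemilinear idfun (fun a b : H =>
  tlift (fun c e : H => lact a (dif1 G c) ⊗ (b * e)) (cop h)).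
Proof.
split=> u c v w; (apply: tlifts_lin => [|||y z]; try exact: rcoact_bi0).
  by rewrite lact_linl tens_linl.
by rewrite mulrDl -scalerAl tens_linr.
Qed.

Lemma rcoact_linear_l h : linear (fun g => rcoact G g h).
Proof. by move=> a x y; rewrite /rcoact cop_linear (tliftsP _ _ _ (rcoact_bi h)). Qed.

Lemma rcoact_linear_r g : linear (rcoact G g).
Proof.
move=> a x y; apply: tlifts_lin => [|||b c]; try exact: rcoact_bi.
by rewrite cop_linear (tliftsP _ _ _ (rcoact_bi0 b c)).
Qed.

Lemma rcoactE m n :
  rcoact G (zp m) (zp n) = lact (zp m) (dif1 G (zp n)) ⊗ zp (m + n).
Proof.
rewrite /rcoact [cop (zp m)]zp_cop (tliftsE _ _ (rcoact_bi _)) zp_cop.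
by rewrite (tliftsE _ _ (rcoact_bi0 _ _)) zpM.
Qed.

(** The quantum Maurer-Cartan form S(g1) dg2, whose kernel in Ker(eps) is the
    right ideal of the calculus. *)
Definition mcform (g : H) : G :=
  tlift (fun a b : H => lact (ant a) (dif1 G b)) (cop g).

Lemma mcform_bi :
  bisemilinear idfun (fun a b : H => lact (ant a) (dif1 G b)).
Proof. by split=> *; rewrite ?ant_linear ?dif1_linear ?lact_linl ?lact_linr. Qed.

Lemma mcform_linear : linear mcform.
Proof. by move=> a x y; rewrite /mcform cop_linear (tliftsP _ _ _ mcform_bi). Qed.

Lemma mcformE n : mcform (zp n) = lact (zp (- n)) (dif1 G (zp n)).
Proof. by rewrite /mcform zp_cop (tliftsE _ _ mcform_bi) zp_ant. Qed.

Lemma dif1_1 : dif1 G 1 = 0.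
Proof.
have := dif1M G 1 1; rewrite mulr1 ract1 lact1.
by move/eqP; rewrite -subr_eq subrr eq_sym => /eqP.
Qed.

Lemma mcform_zp0 : mcform (zp 0) = 0.
Proof. by rewrite (mcformE 0) zp0 dif1_1 (lin0 (lact_linr _)). Qed.

Lemma dif1_mcform n : dif1 G (zp n) = lact (zp n) (mcform (zp n)).
Proof. by rewrite mcformE -lactM zpM addrN zp0 lact1. Qed.

Definition omega : G := mcform (zp 1).

Lemma omegaE : mcform (zp 1) = omega. Proof. by []. Qed.

(** In classical notation, d log z^n = n d log z. *)
Definition logarithmic := forall n, mcform (zp n) = n%:~R *: omega.

(** The element z^n - 1 - n (z - 1) is in Ker^2, so its Maurer-Cartan form
    z^{-n} dz^n - n z^{-1} dz is zero. *)
Lemma classical_logarithmic : classical_calculus G -> logarithmic.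
Proof.
case=> _ rG n; pose g : H := zp n - zp 0 - n%:~R *: (zp 1 - zp 0).
have kg : ker_eps2 g.
  apply/ker_eps2P; split.
    rewrite -[eps g]/((@eps C H : H -> C^o) g) /g.
    rewrite !(linD (@epsP C), linN (@epsP C), linZ (@epsP C)) !zp_eps.
    by rewrite !subrr scaler0 subrr.
  rewrite /g !(linD (@zder_linear C), linN (@zder_linear C), linZ (@zder_linear C)).
  by rewrite !zderE !subr0 -[_ *: _]/(_ * _) mulr1 subrr.
have [_] := (rG g).2 kg; rewrite -/(mcform g) /g.
rewrite !(linD mcform_linear, linN mcform_linear, linZ mcform_linear).
by move/lincomb_eq0; apply; exact: mcform_zp0.
Qed.

(** Otherwise z - 1 would be in the right ideal Ker^2, but its derivative at 1
    is not zero. *)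
Lemma classical_omega_neq0 : classical_calculus G -> omega != 0.
Proof.
case=> _ rG; apply/eqP=> o0.
have /ker_eps2P[_] : ker_eps2 (zp 1 - zp 0).
  apply/(rG _); split.
    rewrite -[eps _]/((@eps C H : H -> C^o) _).
    by rewrite (linD (@epsP C)) (linN (@epsP C)) !zp_eps subrr.
  rewrite -/(mcform _) (linD mcform_linear) (linN mcform_linear) omegaE o0.
  by rewrite mcform_zp0 subrr.
rewrite (linD (@zder_linear C)) (linN (@zder_linear C)) !zderE subr0.
by move/eqP; rewrite oner_eq0.
Qed.

(** The left coaction sends g omega to the sum of the g_k z^k (x) z^k omega.
    It is well defined, so g omega = 0 implies g_k z^k omega = 0 for all k. *)
Lemma classical_free : classical_calculus G ->
  forall g, lact g omega = 0 -> g = 0.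
Proof.
move=> cG g g0.
have lg : lcoact G (g * zp (-1)) (zp 1) = 0.
  have [] := cG.1 [:: (g * zp (-1), zp 1)]; rewrite !big_seq1 //=.
  by rewrite lactM -mcformE.
have ck_bi k : bisemilinear idfun (fun (a : H) (w : G) => zcoef k a *: w).
  split=> [w a u v|v a u w]; first by rewrite zcoef_linear scalerDl scalerA.
  by rewrite scalerDr !scalerA [a * _]mulrC.
apply: zcoef_eq0 => k; apply/eqP.
suff: zcoef k g *: lact (zp k) omega == 0.
  rewrite scaler_eq0 => /orP[//|/eqP e].
  have := classical_omega_neq0 cG.
  by rewrite -[omega]lact1 -zp0 -(addNr k) -zpM lactM e (lin0 (lact_linr _)) eqxx.
rewrite -[X in _ == X](tlifts0 (ck_bi k)) -lg; apply/eqP.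
have lT : linear (tlift (fun (a : H) (w : G) => zcoef k a *: w)).
  by move=> a x y; apply: tliftsP.
move: g {g0 lg}; apply: (zp_lin_ext (lin_scal _ (zcoef_linear k))
  (lin_comp lT (lin_comp (lcoact_linear_l (zp 1)) (mulr_linear_l (zp (-1)))))) => n.
rewrite zpM lcoactE subrK (tliftsE _ _ (ck_bi k)) zcoefE dif1_mcform -lactM zpM.
by rewrite subrK omegaE; case: eqP => [->//|_]; rewrite !scale0r.
Qed.

Lemma form_omega : logarithmic -> forall w, exists g, w = lact g omega.
Proof.
move=> lG w; have := form1_span w; elim=> [|a u v [g [h ->]] _ [k ->]].
  by exists 0; rewrite (lin0 (lact_linl _)).
suff [h' ->] : exists h', dif1 G h = lact h' omega.
  by exists (a *: (g * h') + k); rewrite lact_linl lactM.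
elim/zp_ind: h => [|b n x [h' IH]].
  by exists 0; rewrite (lin0 (dif1_linear G)) (lin0 (lact_linl _)).
exists (b *: (n%:~R *: zp n) + h'); rewrite lact_linl dif1_linear IH.
by rewrite (linZ (lact_linl _)) dif1_mcform lG (linZ (lact_linr _)).
Qed.

(** Comparing the Leibniz rule for z z with dz^2 = 2 z^2 omega gives
    omega z = z omega; the other powers of z follow by induction. *)
Lemma omega_central : logarithmic -> forall g, ract omega g = lact g omega.
Proof.
move=> lG.
have d1 : dif1 G (zp 1) = lact (zp 1) omega by rewrite dif1_mcform.
have z1 : ract omega (zp 1) = lact (zp 1) omega.
  have := dif1M G (zp 1) (zp 1); rewrite zpM dif1_mcform lG d1 lract.
  rewrite (linZ (lact_linr _)) -lactM zpM intrD scalerDl mulr1z scale1r.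
  move/addIr; rewrite -zpM lactM.
  move/(congr1 (lact (zp (-1)))); rewrite -!lactM zpM addNr zp0 !mul1r lact1.
  by move->.
have zS n : ract omega (zp n) = lact (zp n) omega ->
    ract omega (zp (n + 1)) = lact (zp (n + 1)) omega.
  by move=> e; rewrite -zpM ractM e lract z1 -lactM.
have zP n : ract omega (zp n) = lact (zp n) omega ->
    ract omega (zp (n - 1)) = lact (zp (n - 1)) omega.
  have o1 : omega = lact (zp (-1)) (ract omega (zp 1)).
    by rewrite z1 -lactM zpM addNr zp0 lact1.
  move=> e; rewrite {1}o1 lract -ractM zpM addrCA subrr addr0 e -lactM zpM.
  by rewrite addrC.
apply: zp_lin_ext => [||n]; [exact: ract_linr|exact: lact_linl|].
elim/int_ind: n => [|n IH|n IH]; first by rewrite zp0 ract1 lact1.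
  by rewrite -addn1 PoszD; apply: zS.
by rewrite -addn1 PoszD opprD; apply: zP.
Qed.

Lemma star_omega : logarithmic -> star1 omega = - omega.
Proof.
move=> lG; rewrite {1}/omega mcformE star1_lact star1_dif !zp_star opprK.
rewrite dif1_mcform lG lract (linZ (ract_linl _)) (omega_central lG).
by rewrite (linZ (lact_linr _)) -lactM zpM addNr zp0 lact1 mulrN1z scaleN1r.
Qed.

(** The relation z^{-1} dz + z d(z^{-1}) = 0 yields the generator
    dz^{-1} (x) dz + dz (x) dz^{-1} = -2 omega (x) omega of the ideal, and every
    tensor of degree 2 is a multiple of omega (x) omega. *)
Lemma log_square_zero : logarithmic -> square_zero G.
Proof.
move=> lG v w; have [g ->] := form_omega lG v; have [h ->] := form_omega lG w.
pose t := tpow2 omega omega.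
have [_ _ actM act1] := tpow_laws G 2.
have act2 (x y : H) :
    tpow2 (lact x omega) (lact y omega) = @tpow_mul _ _ G 0 2 (x * y) t.
  have e : tpow2 (lact y omega) omega = @tpow_mul _ _ G 0 2 y t.
    by have := tpow2_act y 1 omega omega; rewrite (lact1 omega) ract1.
  rewrite tpow2_act (omega_central lG) e; exact: esym (actM x y t).
rewrite act2; apply: (@env_mull _ _ _ 0 2).
(* Only exponents with sum zero are needed, for which the factor z^{m+n} is 1. *)
have act_dif m n : m + n = 0 ->
    tpow2 (dif1 G (zp m)) (dif1 G (zp n)) = (m%:~R * n%:~R) *: t.
  move=> mn; rewrite !dif1_mcform !lG !(linZ (lact_linr _)).
  rewrite (linZ (tpow2_linl _)) (linZ (tpow2_linr _)) act2 zpM mn zp0.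
  by rewrite scalerA; congr (_ *: _); exact: act1.
have gen : \sum_(p <- [:: (zp (-1), zp 1); (zp 1, zp (-1))])
    lact p.1 (dif1 G p.2) = 0.
  have e1 := mcformE 1; have e2 := mcformE (-1); rewrite opprK in e2.
  rewrite !big_cons big_nil [fst _]/= [snd _]/= -e1 -e2 !lG.
  by rewrite mulrN1z mulr1z scaleN1r scale1r addr0 addrN.
have := env_gen gen; rewrite !big_cons big_nil [fst _]/= [snd _]/=.
rewrite !act_dif ?addNr ?addrN // mulrN1z mulr1z mulN1r mulrN1 addr0 -scalerDl.
(* Divide the generator (-1 - 1) t by its coefficient. *)
move=> it; have := env_lin (-1 - 1)^-1 it (env_0 G 2).
rewrite addr0 scalerA mulVf ?scale1r //.
by rewrite -opprD oppr_eq0 -mulr2n pnatr_eq0.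
Qed.

(** The element z^n - 1 is in the right ideal Ker(eps), hence dz^n = 0. *)
Lemma zero_forms : zero_calculus G -> forall w, w = 0.
Proof.
case=> _ rG; suff d0 g : dif1 G g = 0.
  move=> w; have := form1_span w; elim=> [//|a u v [g [h ->]] _ ->].
  by rewrite d0 (lin0 (lact_linr _)) scaler0 addr0.
move: g; apply: zp_lin_ext => [|a x y|n]; first exact: dif1_linear.
  by rewrite scaler0 addr0.
have [|_] := (rG (zp n - zp 0)).2.
  rewrite -[eps _]/((@eps C H : H -> C^o) _).
  by rewrite (linD (@epsP C)) (linN (@epsP C)) !zp_eps subrr.
rewrite -/(mcform _) (linD mcform_linear) (linN mcform_linear).
rewrite mcform_zp0 subr0.
by rewrite dif1_mcform => ->; rewrite (lin0 (lact_linr _)).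
Qed.

Lemma zero_square_zero : zero_calculus G -> square_zero G.
Proof.
move=> /zero_forms z v w; rewrite (z v) (lin0 (tpow2_linl w)); exact: env_0.
Qed.

End CircleCalculus.

(** * Existence of the two calculi *)

Section Existence.
Variable C : numClosedFieldType.
Local Notation H := (U1 C).
Local Notation zp := (zp C).
Implicit Types (m n : int) (g h v w : H).

(** The operator z d/dz. The calculus is modelled on H itself, where the function
    g stands for the form g z^{-1} dz. *)
Definition cl_dif : H -> H := zext (fun n => n%:~R *: zp n).

Lemma cl_dif_linear : linear cl_dif. Proof. exact: zext_linear. Qed.

Lemma cl_difE n : cl_dif (zp n) = n%:~R *: zp n. Proof. exact: zextE. Qed.

Lemma cl_difM g h : cl_dif (g * h) = cl_dif g * h + g * cl_dif h.
Proof.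
move: g; apply: (zp_lin_ext
  (lin_comp cl_dif_linear (mulr_linear_l h))
  (lin_add (lin_comp (mulr_linear_l h) cl_dif_linear)
     (mulr_linear_l (cl_dif h)))) => m.
move: h; apply: (zp_lin_ext
  (lin_comp cl_dif_linear (mulr_linear_r (zp m)))
  (lin_add (mulr_linear_r (cl_dif (zp m)))
     (lin_comp (mulr_linear_r (zp m)) cl_dif_linear))) => n.
by rewrite zpM !cl_difE -scalerAl -scalerAr zpM -scalerDl -intrD.
Qed.

Lemma cl_span w : Defs.span (fun v => exists g h, v = g * cl_dif h) w.
Proof.
apply: spanS; exists (w * zp (-1)), (zp 1).
by rewrite cl_difE scale1r -mulrA zpM addNr zp0 mulr1.
Qed.

(** The sign comes from (z^{-1} dz)^* = z d(z^{-1}) = - z^{-1} dz. *)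
Definition cl_star w : H := - star w.

Lemma cl_star_antilinear : antilinear cl_star.
Proof. by move=> a x y; rewrite /cl_star star_antilinear opprD scalerN. Qed.

Lemma cl_starK : involutive cl_star.
Proof.
by move=> w; rewrite /cl_star antilinearN ?starK ?opprK //; exact: star_antilinear.
Qed.

Lemma cl_star_mul g w : cl_star (g * w) = cl_star w * star g.
Proof. by rewrite /cl_star starM mulNr. Qed.

Lemma cl_star_dif g : cl_star (cl_dif g) = cl_dif (star g).
Proof.
move: g; apply: (@zp_ext _ _ Num.conj) => [a x y|a x y|n].
- by rewrite cl_dif_linear cl_star_antilinear.
- by rewrite star_antilinear cl_dif_linear.
rewrite zp_star !cl_difE (antilinearZ cl_star_antilinear) rmorph_int.
by rewrite /cl_star zp_star scalerN -scaleNr mulrNz.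
Qed.

Definition classical_fodc : fodc H := @Fodc C H H *%R *%R cl_dif cl_star
  (@mulr_linear_l C) (@mulr_linear_r C)
  (@mulr_linear_l C) (@mulr_linear_r C)
  (@mul1r H) (fun g h w => esym (mulrA g h w)) (@mulr1 H)
  (fun g h w => mulrA w g h) (fun g w h => esym (mulrA g w h))
  cl_dif_linear cl_difM cl_span cl_star_antilinear cl_starK cl_star_mul
  cl_star_dif.

(** Both coactions of g dh are the coproduct of the function that stands for
    g dh, hence depend on the form only. *)
Lemma classical_bicovariant : bicovariant classical_fodc.
Proof.
(* The coproduct, with its values seen as tensors with forms. *)
pose Phi : H -> tensor H classical_fodc := @cop C H.
have lPhi : linear Phi by exact: cop_linear.
have lE g h : lcoact classical_fodc g h = Phi (g * cl_dif h).
  move: g; apply: (zp_lin_ext (lcoact_linear_l _ h)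
    (lin_comp lPhi (mulr_linear_l (cl_dif h)))) => m.
  move: h; apply: (zp_lin_ext (lcoact_linear_r _ _)
    (lin_comp lPhi (lin_comp (mulr_linear_r (zp m)) cl_dif_linear))) => n.
  rewrite lcoactE -[lact _ _]/(zp m * cl_dif (zp n)) cl_difE -scalerAr zpM.
  rewrite (linZ lPhi) /Phi zp_cop.
  exact: (linZ (fun a x y => @tens_linr C H classical_fodc (zp (m + n)) a x y)).
pose Psi : H -> tensor classical_fodc H := @cop C H.
have lPsi : linear Psi by exact: cop_linear.
have rE g h : rcoact classical_fodc g h = Psi (g * cl_dif h).
  move: g; apply: (zp_lin_ext (rcoact_linear_l _ h)
    (lin_comp lPsi (mulr_linear_l (cl_dif h)))) => m.
  move: h; apply: (zp_lin_ext (rcoact_linear_r _ _)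
    (lin_comp lPsi (lin_comp (mulr_linear_r (zp m)) cl_dif_linear))) => n.
  rewrite rcoactE -[lact _ _]/(zp m * cl_dif (zp n)) cl_difE -scalerAr zpM.
  rewrite (linZ lPsi) /Psi zp_cop.
  exact: (linZ (fun a x y => @tens_linl C classical_fodc H (zp (m + n)) a x y)).
move=> s s0; have e (U : lmodType C) (f : H -> U) : linear f ->
    \sum_(p <- s) f (p.1 * cl_dif p.2) = 0.
  by move=> lf; rewrite -(lin_sum lf) [X in f X]s0 (lin0 lf).
split; [apply: etrans (e _ _ lPhi)|apply: etrans (e _ _ lPsi)].
  by apply: eq_bigr => p _; rewrite lE.
by apply: eq_bigr => p _; rewrite rE.
Qed.

(** The Maurer-Cartan form of g is zder g times the generator, so ker_eps2P
    identifies the right ideal. *)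
Lemma classical_fodcP : classical_calculus classical_fodc.
Proof.
split; first exact: classical_bicovariant.
have mE g : mcform classical_fodc g = (zder g : C) *: (1 : H).
  move: g; apply: (zp_lin_ext (@mcform_linear C classical_fodc)
    (lin_scal _ (@zder_linear C))) => n.
  rewrite mcformE zderE -[lact _ _]/(zp (- n) * cl_dif (zp n)) cl_difE.
  by rewrite -scalerAr zpM addNr zp0.
move=> g; rewrite ker_eps2P /right_ideal -/(mcform classical_fodc g) mE.
split=> [[-> /eqP]|[-> ->]]; last by rewrite scale0r.
by rewrite scaler_eq0 oner_eq0 orbF => /eqP.
Qed.

Definition zero_form := 'rV[C]_0.

Lemma zero_formP (v w : zero_form) : v = w.
Proof. by rewrite [v]thinmx0 [w]thinmx0. Qed.

Definition zero_fodc : fodc H.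
Proof.
refine (@Fodc C H zero_form (fun _ _ => 0) (fun _ _ => 0) (fun=> 0) (fun=> 0)
  _ _ _ _ _ _ _ _ _ _ _ _ _ _ _ _);
  do ?by [move=> *; exact: zero_formP | move=> w; exact: zero_formP
  | move=> ? ? ?; exact: zero_formP | move=> ? ? ? ?; exact: zero_formP].
by move=> w; rewrite (zero_formP w 0); exact: span0.
Defined.

Lemma zero_fodcP : zero_calculus zero_fodc.
Proof.
have lin_zero (U V : lmodType C) : linear (fun _ : U => 0 : V).
  by move=> a x y; rewrite scaler0 addr0.
have l0 (g h : H) : lcoact zero_fodc g h = 0.
  move: g; apply: (zp_lin_ext (lcoact_linear_l zero_fodc h) (lin_zero _ _)).
  move=> m; move: h.
  apply: (zp_lin_ext (lcoact_linear_r zero_fodc (zp m)) (lin_zero _ _)) => n.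
  by rewrite lcoactE; exact: tens_0r.
have r0 (g h : H) : rcoact zero_fodc g h = 0.
  move: g; apply: (zp_lin_ext (rcoact_linear_l zero_fodc h) (lin_zero _ _)).
  move=> m; move: h.
  apply: (zp_lin_ext (rcoact_linear_r zero_fodc (zp m)) (lin_zero _ _)) => n.
  by rewrite rcoactE; exact: tens_0l.
split=> [s _|g]; first by split; apply: big1_seq => p _; rewrite ?l0 ?r0.
by split=> [[]//|e]; split=> //; exact: zero_formP.
Qed.

Lemma calculi_exist : exists (Gc : fodc H) (Omega : envelope Gc)
  (G : fodc H) (W : envelope G), classical_calculus Gc /\ zero_calculus G.
Proof.
have clP := classical_fodcP; have zP := zero_fodcP.
have [Omega] := envelope_exists (log_square_zero (classical_logarithmic clP)).
have [W] := envelope_exists (zero_square_zero zP).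
by exists classical_fodc, Omega, zero_fodc, W.
Qed.

End Existence.

(** * Linearity of the graded tensor operations *)

Section GradedTensorLinearity.
Variables (C : numClosedFieldType) (A B : gdsa C).

Lemma gtmul_linear_l (t : tensor A B) : linear (fun s => gtmul s t).
Proof. by move=> a x y; apply/tliftsP/gtmul_bi. Qed.

Lemma gtmul_linear_r (s : tensor A B) : linear (gtmul s).
Proof.
move=> a x y; apply: tlifts_lin => [|||u v]; try exact: gtmul_bi.
exact/tliftsP/gtmul_bi0.
Qed.

Lemma gtdif_linear : linear (@gtdif C A B).
Proof. by move=> a x y; apply/tliftsP/gtdif_bi. Qed.

Lemma gtstar_antilinear : antilinear (@gtstar C A B).
Proof.
move=> a x y; apply: tliftsP.
by split=> *; rewrite gstar_antilinear ?tens_linl ?tens_linr.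
Qed.

End GradedTensorLinearity.

(** * The quantum principal bundle *)

Section Bundle.
Variable C : numClosedFieldType.
Local Notation H := (U1 C).
Local Notation zp := (zp C).

Lemma coef_bi (V : lmodType C) k :
  bisemilinear idfun (fun (v : V) (h : H) => zcoef k h *: v).
Proof.
split=> [w a u v|v a u w]; last by rewrite zcoef_linear scalerDl scalerA.
by rewrite scalerDr !scalerA [a * _]mulrC.
Qed.

(** Applied to a coinvariant v (x) 1, this returns v. *)
Definition coef0 (V : lmodType C) : tensor V H -> V :=
  tlift (fun v h => zcoef 0 h *: v).

Lemma coef0_linear V : linear (@coef0 V).
Proof. by move=> a x y; apply/tliftsP/coef_bi. Qed.

Lemma coef0E V v h : @coef0 V (v ⊗ h) = zcoef 0 h *: v.
Proof. exact/tliftsE/coef_bi. Qed.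

Lemma scalars_linear a (x y : H) : scalars x -> scalars y -> scalars (a *: x + y).
Proof.
by move=> [b ->] [c ->]; exists (a * b + c); rewrite scalerDl scalerA.
Qed.

(** A coinvariant x is coef0 (cop x), and coef0 (cop z^n) is 1 or 0. *)
Lemma coinvariants (x : H) : cop x = x ⊗ 1 <-> scalars x.
Proof.
split=> [e|[a ->]]; last first.
  rewrite (linZ (@cop_linear C)) -zp0 zp_cop.
  by rewrite (linZ (fun b u v => @tens_linl C H H (zp 0) b u v)).
have -> : x = coef0 (cop x).
  by rewrite e coef0E -zp0 zcoefE eqxx scale1r.
elim/zp_ind: (x) => [|a n y IH].
  by exists 0; rewrite (lin0 (@cop_linear C)) (lin0 (@coef0_linear H)) scale0r.
rewrite cop_linear coef0_linear; apply: scalars_linear IH.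
rewrite zp_cop coef0E zcoefE; case: eqP => [->|_].
  by exists 1; rewrite zp0.
by exists 0; rewrite !scale0r.
Qed.

(** The tensor v z^{-n} (x) z^n is sent to v (x) z^n. *)
Lemma bundle_free (t : tensor H H) : exists s : tensor H H,
  tlift (fun x y : H => tmul (x ⊗ 1) (cop y)) s = t.
Proof.
have bi : bisemilinear idfun (fun x y : H => tmul (x ⊗ 1) (cop y)).
  split=> [w a u v|v a u w]; first by rewrite tens_linl tmul_linl.
  by rewrite cop_linear tmul_linr.
have lin : linear (tlift (fun x y : H => tmul (x ⊗ 1) (cop y))).
  by move=> a x y; apply: tliftsP.
suff gen (v w : H) : exists s : tensor H H,
    tlift (fun x y : H => tmul (x ⊗ 1) (cop y)) s = v ⊗ w.
  elim/tens_ind: t => [|a v w t [s IH]]; first by exists 0; rewrite (lin0 lin).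
  by have [u hu] := gen v w; exists (a *: u + s); rewrite lin hu IH.
elim/zp_ind: w => [|a n w [s IH]]; first by exists 0; rewrite (lin0 lin) tens_0r.
exists (a *: ((v * zp (- n)) ⊗ zp n) + s); rewrite lin IH tens_linr.
by rewrite (tliftsE _ _ bi) zp_cop tmulE mul1r -mulrA zpM addNr zp0 mulr1.
Qed.

Lemma U1_qpb : is_qpb (@scalars C) (@cop C H).
Proof.
split; last exact: bundle_free.
- split; first by exists 1; rewrite scale1r.
  + exact: scalars_linear.
  + by move=> x y [a ->] [b ->]; exists (a * b);
      rewrite -scalerAl mul1r scalerA.
  + move=> x [a ->]; exists a^*.
    rewrite (antilinearZ (@star_antilinear C H)) -zp0.
    by rewrite zp_star oppr0.
- exact: cop_morphism.
- exact: copA.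
- exact: cop_eps.
- exact: coinvariants.
Qed.

End Bundle.

(** * Forms of the classical calculus *)

Section CircleForms.
Variables (C : numClosedFieldType) (Gc : fodc (U1 C)) (Omega : envelope Gc).
Local Notation H := (U1 C).
Local Notation zp := (zp C).
Local Notation pz := (pi_z Omega).
Hypothesis cG : classical_calculus Gc.
Implicit Types (g h : H) (m n : int).

Let lG : logarithmic Gc := classical_logarithmic cG.
Let G2 : square_zero Gc := log_square_zero lG.

(** Together, zform0 n = z^n and zform1 n = z^n pi(z) form a basis of the
    envelope. *)
Definition zform0 n : Omega := env_in Omega (zp n).
Definition zform1 n : Omega := env_in Omega (zp n) * pz.

Lemma pi_zE : pz = env_form Omega (omega Gc).
Proof.
have zE : U1z C = zp 1 by rewrite zp.unlock.
by rewrite /pi_z zE zp_ant env_in_dif env_lactE -mcformE.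
Qed.

Lemma mul_pi_z g : env_in Omega g * pz = env_form Omega (lact g (omega Gc)).
Proof. by rewrite pi_zE env_lactE. Qed.

Lemma pi_z_central g : pz * env_in Omega g = env_in Omega g * pz.
Proof. by rewrite mul_pi_z pi_zE env_ractE omega_central. Qed.

Lemma pi_z_sqr : pz * pz = 0.
Proof. by rewrite pi_zE env_formM0. Qed.

Lemma homog_mul_pi_z (w : Omega) :
  homog 1 w <-> exists g, w = env_in Omega g * pz.
Proof.
rewrite homog_env_form; split=> [[v ->]|[g ->]]; last first.
  by exists (lact g (omega Gc)); rewrite mul_pi_z.
by have [g ->] := form_omega lG v; exists g; rewrite mul_pi_z.
Qed.

Lemma mul_pi_z_linear : linear (fun g => env_in Omega g * pz).
Proof. by move=> a x y; rewrite env_in_linear mulrDl scalerAl. Qed.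

Lemma circle_form_decomp (w : Omega) :
  exists p : H * H, w = env_in Omega p.1 + env_in Omega p.2 * pz.
Proof.
have [g [v ->]] := env_decomp G2 w; have [h ->] := form_omega lG v.
by exists (g, h); rewrite mul_pi_z.
Qed.

Lemma circle_form_inj (p q : H * H) :
  env_in Omega p.1 + env_in Omega p.2 * pz =
  env_in Omega q.1 + env_in Omega q.2 * pz -> p = q.
Proof.
case: p q => [g h] [g' h'] /=; rewrite !mul_pi_z => /env_decomp_inj[-> e].
congr (_, _); apply/eqP; rewrite -subr_eq0; apply/eqP/(classical_free cG).
rewrite (linD (lact_linl _)) (linN (lact_linl _)) e; exact: subrr.
Qed.

(** Semilinear maps, such as the involutions, are also compared on the basis. *)
Lemma circle_form_ext (U : lmodType C) (s : {rmorphism C -> C})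
    (f g : Omega -> U) :
  (forall a x y, f (a *: x + y) = s a *: f x + f y) ->
  (forall a x y, g (a *: x + y) = s a *: g x + g y) ->
  (forall n, f (zform0 n) = g (zform0 n)) ->
  (forall n, f (zform1 n) = g (zform1 n)) -> f =1 g.
Proof.
move=> lf lg e0 e1 w; have [[x y] ->] := circle_form_decomp w.
rewrite -[env_in Omega _]scale1r lf lg; congr (_ *: _ + _).
  move: x; apply: (@zp_ext _ _ s) => [a u v|a u v|n];
    by rewrite ?env_in_linear ?lf ?lg //; exact: e0.
move: y => /=; apply: (@zp_ext _ _ s (fun y => f (env_in Omega y * pz))
  (fun y => g (env_in Omega y * pz))) => [a u v|a u v|n];
  by rewrite ?mul_pi_z_linear ?lf ?lg //; exact: e1.
Qed.

Lemma zform0M m n : zform0 m * zform0 n = zform0 (m + n).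
Proof. by rewrite /zform0 -env_inM zpM. Qed.

Lemma zform01M m n : zform0 m * zform1 n = zform1 (m + n).
Proof. by rewrite /zform1 mulrA; congr (_ * pz); exact: zform0M. Qed.

Lemma zform10M m n : zform1 m * zform0 n = zform1 (m + n).
Proof. by rewrite -mulrA pi_z_central mulrA; congr (_ * pz); exact: zform0M. Qed.

Lemma zform11M m n : zform1 m * zform1 n = 0.
Proof.
by rewrite -mulrA [pz * _]mulrA pi_z_central -[_ * _ * pz]mulrA pi_z_sqr !mulr0.
Qed.

Lemma zform0_homog n : homog 0 (zform0 n).
Proof. by apply/homog_env_in; exists (zp n). Qed.

Lemma zform1_homog n : homog 1 (zform1 n).
Proof. by apply/homog_mul_pi_z; exists (zp n). Qed.

Lemma zform0_dif n : dif (zform0 n) = n%:~R *: zform1 n.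
Proof.
rewrite env_in_dif dif1_mcform lG (linZ (lact_linr _)).
by rewrite (linZ (@env_form_linear _ _ _ Omega)) -mul_pi_z.
Qed.

Lemma zform1_dif n : dif (zform1 n) = 0.
Proof. by rewrite /zform1 mul_pi_z env_form_dif. Qed.

Lemma zform0_star n : gstar (zform0 n) = zform0 (- n).
Proof. by rewrite env_in_star zp_star. Qed.

Lemma pi_z_star : gstar pz = - pz.
Proof.
by rewrite pi_zE env_form_star star_omega // (linN (@env_form_linear _ _ _ Omega)).
Qed.

Lemma zform1_star n : gstar (zform1 n) = - zform1 (- n).
Proof.
have hp : homog 1 pz by apply/homog_env_form; exists (omega Gc); rewrite pi_zE.
rewrite (gstarM (zform0_homog n) hp) mul0n expr0 scale1r pi_z_star.
by rewrite zform0_star mulNr pi_z_central.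
Qed.

Lemma zform0_0 : zform0 0 = 1.
Proof. by rewrite /zform0 zp0 env_in1. Qed.

Lemma zform1_0 : zform1 0 = pz.
Proof. by rewrite /zform1 zp0 env_in1 mul1r. Qed.

Lemma circle_forms_free (w : Omega) : exists! p : H * H,
  w = env_in Omega p.1 + env_in Omega p.2 * pz.
Proof.
have [p e] := circle_form_decomp w; exists p; split=> // q.
by rewrite e => /circle_form_inj.
Qed.

Lemma pi_z_neq0 : pz != 0.
Proof.
apply/eqP=> e; have := @circle_form_inj (0, 0) (0, 1).
rewrite /= e !mulr0 => /(_ erefl) /(congr1 snd) /esym /eqP.
by apply/negP; exact: (oner_neq0 H).
Qed.

End CircleForms.

(** * The coaction and its base forms *)

Section CircleCoaction.
Variables (C : numClosedFieldType) (Gc : fodc (U1 C)) (Omega : envelope Gc).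
Variables (G : fodc (U1 C)) (W : envelope G).
Local Notation H := (U1 C).
Local Notation zp := (zp C).
Local Notation pz := (pi_z Omega).
Local Notation zform0 := (zform0 Omega).
Local Notation zform1 := (zform1 Omega).
Hypothesis cG : classical_calculus Gc.
Hypothesis zG : zero_calculus G.
Implicit Types (g h : H) (m n : int).

Definition zgroup n : W := env_in W (zp n).

Lemma zero_envelope_surj (u : W) : exists h, u = env_in W h.
Proof.
have [h [w ->]] := env_decomp (zero_square_zero zG) u; exists h.
by rewrite (zero_forms zG w) (lin0 (@env_form_linear _ _ _ W)) addr0.
Qed.

(** The inverse of env_in, which is bijective since all forms of G vanish. *)
Definition group_part (u : W) : H := projT1 (cid (zero_envelope_surj u)).

Lemma group_partK : cancel group_part (env_in W).
Proof. by move=> u; rewrite /group_part; case: cid. Qed.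

Lemma env_inK : cancel (env_in W) group_part.
Proof. by move=> h; apply: (@env_in_inj _ _ _ W); rewrite group_partK. Qed.

Lemma group_part_linear : linear group_part.
Proof.
move=> a u v; apply: (@env_in_inj _ _ _ W).
by rewrite env_in_linear !group_partK.
Qed.

Lemma zgroup_homog n : homog 0 (zgroup n).
Proof. by apply/homog_env_in; exists (zp n). Qed.

Lemma zgroup_dif n : dif (zgroup n) = 0.
Proof.
rewrite env_in_dif (zero_forms zG (dif1 G _)).
exact: (lin0 (@env_form_linear _ _ _ W)).
Qed.

Lemma zgroupM m n : zgroup m * zgroup n = zgroup (m + n).
Proof. by rewrite /zgroup -env_inM zpM. Qed.

Lemma zgroup_star n : gstar (zgroup n) = zgroup (- n).
Proof. by rewrite env_in_star zp_star. Qed.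

Lemma zgroup0 : zgroup 0 = 1.
Proof. by rewrite /zgroup zp0 env_in1. Qed.

Lemma coact1_bi :
  bisemilinear idfun (fun a b : H => (env_in Omega a * pz) ⊗ env_in W b).
Proof.
by split=> *; rewrite ?(mul_pi_z_linear Omega) ?env_in_linear ?tens_linl ?tens_linr.
Qed.

(** The two formulas defining the coaction are linear in the two components of a
    form, which are unique. *)
Lemma circle_coaction_exists :
  exists coact : Omega -> tensor Omega W, U1_coaction coact.
Proof.
have [dec decE] : exists dec : Omega -> H * H, forall w,
    env_in Omega (dec w).1 + env_in Omega (dec w).2 * pz = w.
  exists (fun w => projT1 (cid (circle_form_decomp cG w))) => w.
  by case: cid.
have decK g h : dec (env_in Omega g + env_in Omega h * pz) = (g, h).
  by apply: (circle_form_inj cG).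
pose c0 g := tmap (env_in Omega) (env_in W) (cop g).
pose c1 h : tensor Omega W :=
  tlift (fun a b : H => (env_in Omega a * pz) ⊗ env_in W b) (cop h).
have l0 : linear c0.
  move=> a x y; rewrite /c0 cop_linear.
  exact: (tmap_linear (@env_in_linear _ _ _ Omega) (@env_in_linear _ _ _ W)).
have l1 : linear c1.
  by move=> a x y; rewrite /c1 cop_linear (tliftsP _ _ _ coact1_bi).
exists (fun w => c0 (dec w).1 + c1 (dec w).2); split.
- move=> a x y; have -> : dec (a *: x + y) = a *: dec x + dec y.
    rewrite -[x in LHS]decE -[y in LHS]decE.
    rewrite scalerDr addrACA scalerAl -mulrDl.
    rewrite -!(linZ (@env_in_linear _ _ _ Omega)).
    by rewrite -!(linD (@env_in_linear _ _ _ Omega)) decK.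
  by rewrite l0 l1 scalerDr addrACA.
- move=> g; have := decK g 0.
  rewrite (lin0 (@env_in_linear _ _ _ Omega)) mul0r addr0 => -> /=.
  by rewrite (lin0 l1) addr0.
move=> h; have := decK 0 h.
rewrite (lin0 (@env_in_linear _ _ _ Omega)) add0r => -> /=.
by rewrite (lin0 l0) add0r.
Qed.

Variable coact : Omega -> tensor Omega W.
Hypothesis coactP : U1_coaction coact.

Lemma coact_linear : linear coact.
Proof. by case: coactP. Qed.

Lemma coact_zform0 n : coact (zform0 n) = zform0 n ⊗ zgroup n.
Proof.
case: coactP => _ c0 _; rewrite c0 zp_cop.
exact: (tmapE _ _ (@env_in_linear _ _ _ Omega) (@env_in_linear _ _ _ W)).
Qed.

Lemma coact_zform1 n : coact (zform1 n) = zform1 n ⊗ zgroup n.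
Proof.
by case: coactP => _ _ c1; rewrite c1 zp_cop (tliftsE _ _ coact1_bi).
Qed.

Lemma coact_unique (coact' : Omega -> tensor Omega W) :
  U1_coaction coact' -> forall w, coact' w = coact w.
Proof.
case=> l' c0' c1'; have [l c0 c1] := coactP.
move=> w; have [[g h] ->] := circle_form_decomp cG w.
by rewrite (linD l') (linD l) c0 c0' c1 c1'.
Qed.

Lemma gthom_lin k a (s t : tensor Omega W) :
  gthom k s -> gthom k t -> gthom k (a *: s + t).
Proof. exact: span_linP. Qed.

Lemma coact_homog k w : homog k w -> gthom k (coact w).
Proof.
have gt0 j : gthom j (0 : tensor Omega W) by exact: span0.
have lE := @env_in_linear _ _ _ Omega.
case: k => [|[|k]] hw.
- have [g ->] := (homog_env_in w).1 hw.
  elim/zp_ind: g => [|a n x IH]; first by rewrite (lin0 lE) (lin0 coact_linear).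
  rewrite lE coact_linear; apply: gthom_lin IH; apply: spanS.
  exists 0%N, 0%N, (zform0 n), (zgroup n); split=> //.
  + exact: zform0_homog.
  + exact: zgroup_homog.
  exact: coact_zform0.
- have [g ->] := (homog_mul_pi_z cG w).1 hw.
  elim/zp_ind: g => [|a n x IH].
    by rewrite (lin0 lE) mul0r (lin0 coact_linear).
  rewrite (mul_pi_z_linear Omega) coact_linear; apply: gthom_lin IH.
  apply: spanS; exists 1%N, 0%N, (zform1 n), (zgroup n); split=> //.
  + exact: zform1_homog.
  + exact: zgroup_homog.
  exact: coact_zform1.
rewrite (homog_ge2 (log_square_zero (classical_logarithmic cG)) hw).
by rewrite (lin0 coact_linear).
Qed.

(** No sign occurs, because the second factor has degree 0. *)
Lemma gtmul_zgroup m n (x y : Omega) i j : homog i x -> homog j y ->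
  gtmul (x ⊗ zgroup m) (y ⊗ zgroup n) = (x * y) ⊗ zgroup (m + n).
Proof.
move=> hx hy; rewrite (gtmulE _ _ (zgroup_homog m) hy) mul0n expr0 scale1r.
by rewrite zgroupM.
Qed.

Lemma coactM x y : coact (x * y) = gtmul (coact x) (coact y).
Proof.
have mulL (u : Omega) : linear (fun v : Omega => u * v).
  by move=> a v v'; rewrite mulrDr scalerAr.
have mulR (u : Omega) : linear (fun v : Omega => v * u).
  by move=> a v v'; rewrite mulrDl scalerAl.
have lc := coact_linear.
have ext (f1 f2 : Omega -> tensor Omega W) :=
  @circle_form_ext _ _ Omega cG (tensor Omega W) idfun f1 f2.
have h0 := zform0_homog Omega; have h1 := zform1_homog Omega cG.
move: x; apply: (ext _ _ (lin_comp lc (mulR y))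
  (lin_comp (@gtmul_linear_l _ _ _ (coact y)) lc)) => m;
move: y; apply: (ext _ _ (lin_comp lc (mulL _))
  (lin_comp (@gtmul_linear_r _ _ _ (coact _)) lc)) => n.
- rewrite !coact_zform0 (gtmul_zgroup _ _ (h0 m) (h0 n)) (zform0M Omega).
  by rewrite coact_zform0.
- rewrite coact_zform0 coact_zform1 (gtmul_zgroup _ _ (h0 m) (h1 n)).
  by rewrite (zform01M Omega) coact_zform1.
- rewrite coact_zform0 coact_zform1 (gtmul_zgroup _ _ (h1 m) (h0 n)).
  by rewrite (zform10M Omega cG) coact_zform1.
rewrite !coact_zform1 (gtmul_zgroup _ _ (h1 m) (h1 n)).
by rewrite (zform11M Omega cG) tens_0l (lin0 lc).
Qed.

Lemma coact_dif x : coact (dif x) = gtdif (coact x).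
Proof.
have lc := coact_linear.
move: x; apply: (@circle_form_ext _ _ Omega cG _ idfun _ _
  (lin_comp lc (@dif_linear _ Omega)) (lin_comp (@gtdif_linear _ _ _) lc)) => n.
  rewrite (zform0_dif Omega cG) (linZ lc) coact_zform1 coact_zform0.
  rewrite (gtdifE _ (zform0_homog Omega n)) zgroup_dif tens_0r scaler0 addr0.
  rewrite (zform0_dif Omega cG).
  by rewrite (linZ (fun a u v => @tens_linl C Omega W (zgroup n) a u v)).
rewrite (zform1_dif Omega cG) (lin0 lc) coact_zform1.
rewrite (gtdifE _ (zform1_homog Omega cG n)) (zform1_dif Omega cG) zgroup_dif.
by rewrite tens_0r tens_0l scaler0 addr0.
Qed.

Lemma coact_star x : coact (gstar x) = gtstar (coact x).
Proof.
have lc := coact_linear.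
move: x; apply: (@circle_form_ext _ _ Omega cG _ Num.conj) => [a x y|a x y|n|n].
- by rewrite gstar_antilinear lc.
- by rewrite lc gtstar_antilinear.
- by rewrite (zform0_star Omega) !coact_zform0 gtstarE (zform0_star Omega) zgroup_star.
rewrite (zform1_star Omega cG) (linN lc) !coact_zform1 gtstarE.
rewrite (zform1_star Omega cG) zgroup_star.
by rewrite (linN (fun a u v => @tens_linl C Omega W (zgroup (- n)) a u v)).
Qed.

Lemma coact1 : coact 1 = 1 ⊗ 1.
Proof. by rewrite -(zform0_0 Omega) coact_zform0 zgroup0. Qed.

Lemma circle_is_calculus : is_calculus (env_in Omega) (@cop C H) coact.
Proof.
split.
- exact: env_degree0.
- exact/env_generated/log_square_zero/classical_logarithmic.
- by case: zG.
- split; [exact: coact_linear|exact: coact_homog|exact: coact1|exact: coactM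
    |exact: coact_dif|exact: coact_star].
by case: coactP.
Qed.

Lemma base_coef0_bi : bisemilinear idfun
  (fun (x : Omega) (u : W) => zcoef 0 (group_part u) *: x).
Proof.
split=> [w a u v|v a u w].
  by rewrite scalerDr !scalerA [a * _]mulrC.
by rewrite group_part_linear zcoef_linear scalerDl scalerA.
Qed.

(** If coact w = w (x) 1, then w is the coefficient of z^0 in the second factor
    of coact w; on the basis this coefficient vanishes except for 1 and pi(z). *)
Lemma circle_base_form w : base_form coact w <->
  exists a b : C, w = a%:A + b *: pz.
Proof.
have lc := coact_linear.
split=> [e|[a [b ->]]]; last first.
  rewrite /base_form (linD lc) !(linZ lc) coact1 -zform1_0 coact_zform1 zgroup0.
  by rewrite tens_linl (linZ (fun c u v => @tens_linl C Omega W 1 c u v)).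
pose T : tensor Omega W -> Omega :=
  tlift (fun x u => zcoef 0 (group_part u) *: x).
have lT : linear T by move=> a x y; apply/tliftsP/base_coef0_bi.
have TE x n : T (x ⊗ zgroup n) = (n == 0)%:R *: x.
  by rewrite /T (tliftsE _ _ base_coef0_bi) env_inK zcoefE.
have -> : w = T (coact w).
  by rewrite e -zgroup0 TE eqxx scale1r.
have [[x y] ->] := circle_form_decomp cG w; rewrite (linD lc) (linD lT).
have [a ->] : exists a : C, T (coact (env_in Omega x)) = a%:A.
  elim/zp_ind: x => [|a n x [b IH]].
    exists 0; rewrite (lin0 (@env_in_linear _ _ _ Omega)) (lin0 lc) (lin0 lT).
    by rewrite scale0r.
  exists (a * (n == 0)%:R + b); rewrite env_in_linear lc lT IH coact_zform0 TE.
  rewrite scalerDl scalerA; congr (_ + _).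
  by case: eqP => [->|_]; rewrite ?mulr0 ?scale0r // zform0_0.
have [b ->] : exists b : C, T (coact (env_in Omega y * pz)) = b *: pz.
  elim/zp_ind: y => [|b n y [d IH]].
    exists 0; rewrite (lin0 (@env_in_linear _ _ _ Omega)) mul0r (lin0 lc).
    by rewrite (lin0 lT) scale0r.
  exists (b * (n == 0)%:R + d).
  rewrite (mul_pi_z_linear Omega) lc lT IH coact_zform1 TE.
  rewrite scalerDl scalerA; congr (_ + _).
  by case: eqP => [->|_]; rewrite ?mulr0 ?scale0r // zform1_0.
by exists a, b.
Qed.

Lemma pi_z_homog1 (b : C) : homog 1 (b *: pz).
Proof.
by apply/(homog_mul_pi_z cG); exists (b%:A); rewrite env_in_alg -scalerAl mul1r.
Qed.

Lemma scalar_homog0 (a : C) : homog 0 (a%:A : Omega).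
Proof. by apply/homog_env_in; exists (a%:A); rewrite env_in_alg. Qed.

Lemma circle_base0 w : (base_form coact w /\ homog 0 w) <->
  exists x : H, scalars x /\ w = env_in Omega x.
Proof.
split=> [[/circle_base_form [a [b ->]]]|[x [[a ->] ->]]]; last first.
  rewrite env_in_alg; split; last exact: scalar_homog0.
  by apply/circle_base_form; exists a, 0; rewrite scale0r addr0.
move=> <-; rewrite (linD (@hcomp_linear _ Omega 0)) (scalar_homog0 a).
rewrite (hcomp_hom _ (pi_z_homog1 b)) /= addr0.
by exists (a%:A); split; [exists a|rewrite env_in_alg].
Qed.

Lemma circle_base1 w : (base_form coact w /\ homog 1 w) <->
  exists b : C, w = b *: pz.
Proof.
split=> [[/circle_base_form [a [b ->]]]|[b ->]]; last first.
  split; last exact: pi_z_homog1.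
  by apply/circle_base_form; exists 0, b; rewrite scale0r add0r.
move=> <-; rewrite (linD (@hcomp_linear _ Omega 1)) (pi_z_homog1 b).
by exists b; rewrite (hcomp_hom _ (scalar_homog0 a)) /= add0r.
Qed.

(** A generator of degree 1 is x_0 d(b 1) = 0, but pi(z) is a nonzero base form. *)
Lemma circle_base_not_generated : ~ generated_by (base_form coact)
  (fun w => exists x : H, scalars x /\ w = env_in Omega x).
Proof.
move/(_ 1%N pz) => [gen _].
have {gen} : gen_deg (fun w => exists x : H, scalars x /\ w = env_in Omega x)
    1 pz.
  by apply/gen/circle_base1; exists 1; rewrite scale1r.
suff gen0 w : gen_deg (fun w => exists x : H, scalars x /\ w = env_in Omega x)
    1 w -> w = 0.
  by move/gen0/eqP; apply/negP/(pi_z_neq0 Omega cG).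
elim=> [//|a u v [x0 [s [_ Xs ss ->]]] _ ->]; rewrite addr0.
case: s ss Xs => [//|y [|//]] _ /(_ y (mem_head _ _)) [x [[b ->] ->]].
rewrite big_seq1 env_in_dif (linZ (dif1_linear Gc)) dif1_1 scaler0.
by rewrite (lin0 (@env_form_linear _ _ _ Omega)) mulr0 scaler0.
Qed.

End CircleCoaction.

Theorem mainTheorem8 (R : realType) :
  (* zeta is a quantum principal bundle *)
  is_qpb (@scalars R[i]) (@cop _ (U1 R[i])) /\
  (* the two first order calculi and their envelopes exist *)
  (exists (Gc : fodc (U1 R[i])) (Omega : envelope Gc)
          (G : fodc (U1 R[i])) (W : envelope G),
     classical_calculus Gc /\ zero_calculus G) /\
  forall (Gc : fodc (U1 R[i])) (Omega : envelope Gc)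
         (G : fodc (U1 R[i])) (W : envelope G),
    classical_calculus Gc -> zero_calculus G ->
    (* Omega(P) = P (+) P pi(z) *)
    (forall w : Omega, exists! p : U1 R[i] * U1 R[i],
       w = env_in Omega p.1 + env_in Omega p.2 * pi_z Omega) /\
    (* Gamma = 0 and its envelope is H *)
    (forall w : G, w = 0) /\ bijective (env_in W) /\
    (* the coaction is well defined by its values *)
    exists coact : Omega -> tensor Omega W,
      U1_coaction coact /\
      (forall coact' : Omega -> tensor Omega W,
         U1_coaction coact' -> forall w, coact' w = coact w) /\
      is_calculus (env_in Omega) (@cop _ (U1 R[i])) coact /\
      (* the base forms and their homogeneous parts *)
      (forall w : Omega, base_form coact w <->
         exists a b : R[i], w = a%:A + b *: pi_z Omega) /\
      (forall w : Omega, (base_form coact w /\ homog 0 w) <->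
         exists x : U1 R[i], scalars x /\ w = env_in Omega x) /\
      (forall w : Omega, (base_form coact w /\ homog 1 w) <->
         exists b : R[i], w = b *: pi_z Omega) /\
      ~ generated_by (base_form coact)
          (fun w => exists x : U1 R[i], scalars x /\ w = env_in Omega x).
Proof.
split; first exact: U1_qpb.
split; first exact: calculi_exist.
move=> Gc Omega G W cG zG; split; first exact: circle_forms_free.
split; first exact: zero_forms.
split; first by exists (group_part zG); [exact: env_inK|exact: group_partK].
have [coact coactP] := circle_coaction_exists Omega W cG.
exists coact; split; first exact: coactP.
split; first exact: coact_unique.
split; first exact: circle_is_calculus.
split; first exact: circle_base_form.
split; first exact: circle_base0.
split; first exact: circle_base1.
exact: circle_base_not_generated.
Qed.
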